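(* Let $A\neq0$, let $M_A\subset\mathbb{R}^6$ be the $5$-dimensional submanifold of triples of points $(x_i,y_i)$, $i=1,2,3$, in the plane spanning a triangle of signed area $A$, let $$Z_i=(x_{i+1}-x_{i+2})\,\partial_{x_i}+(y_{i+1}-y_{i+2})\,\partial_{y_i},\qquad i=1,2,3\ (\text{indices mod }3),$$ and let $\mathcal{D}=\mathrm{Span}(Z_1-Z_2,Z_3-Z_1)$, a $(2,3,5)$ distribution on $M_A$. Then $\mathcal{D}$ is locally equivalent to the homogeneous $(2,3,5)$ distribution on the Lie group $\mathbf{SL}(2,\mathbb{R})\ltimes\mathbb{R}^2$ defined as the annihilator of the three Maurer–Cartan forms $$\theta^1=\tau^3-\tau^5,\qquad \theta^2=\tau^4+\tau^5,\qquad \theta^3=\tau^1-\tau^2-\tau^3,$$ where the forms $\tau^i$ are defined by $h^{-1}\,dh=\sum_{i=1}^6\tau^iE_i$, with $h$ the general element $$h=\begin{pmatrix} a & b & x \\ p & q & y \\ 0 & 0 & 1 \end{pmatrix},\qquad aq-bp=1,$$ of $\mathbf{SL}(2,\mathbb{R})\ltimes\mathbb{R}^2$, and $$E_1=\begin{pmatrix}0&1&0\\0&0&0\\0&0&0\end{pmatrix},\ E_2=\begin{pmatrix}0&0&0\\1&0&0\\0&0&0\end{pmatrix},\ E_3=\begin{pmatrix}1&0&0\\0&-1&0\\0&0&0\end{pmatrix},$$ $$E_4=\begin{pmatrix}0&0&1\\0&0&0\\0&0&0\end{pmatrix},\ E_5=\begin{pmatrix}0&0&0\\0&0&1\\0&0&0\end{pmatrix},\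 E_6=\begin{pmatrix}1&0&0\\0&1&0\\0&0&0\end{pmatrix}$$ (so that $\tau^6=0$ on $\mathbf{SL}(2,\mathbb{R})\ltimes\mathbb{R}^2$).
   Context: A point of $\mathbb{R}^6$ with coordinates $(x_1,y_1,x_2,y_2,x_3,y_3)$ encodes three points (''ants'') $\vec r_i=(x_i,y_i)$ in the plane; the signed area is $A=\tfrac12\sum_{i=1}^3(y_ix_{i+1}-x_iy_{i+1})$. The $Z_i$ span the velocity distribution of the rule ''the velocity $\dot{\vec r}_i$ is parallel to $\vec r_{i+1}-\vec r_{i+2}$'' (Rule B) and are tangent to every $M_A$. For a distribution put $\mathcal{D}^0=\mathcal D$, $\mathcal{D}^{I+1}=[\mathcal{D}^I,\mathcal{D}^I]+\mathcal{D}^I$; a rank $2$ distribution on a $5$-manifold is a $(2,3,5)$ distribution if $\mathcal{D},\mathcal{D}^1,\mathcal{D}^2$ have ranks $2,3,5$ at every point. Distributions $\mathcal{D}_1$ on $M_1$ and $\mathcal{D}_2$ on $M_2$ are locally equivalent if there is a local diffeomorphism $\phi:M_1\to M_2$ (defined near any given point of $M_1$) with $\phi_*\mathcal{D}_1=\mathcal{D}_2$. A distribution on a manifold is called homogeneous if its (local) symmetries act (locally) transitively on the manifold. *)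

(* Defs.v *)
From HB Require Import structures.
From mathcomp Require Import all_boot all_order all_algebra.
From mathcomp Require Import all_classical all_reals all_analysis.

Set Implicit Arguments.
Unset Strict Implicit.
Unset Printing Implicit Defensive.

Import Order.TTheory GRing.Theory Num.Theory.
Import numFieldNormedType.Exports.

Local Open Scope classical_set_scope.
Local Open Scope ring_scope.

(* Manifolds are smooth submanifolds of a space of matrices 'M[R]_(m, n), seen
   as R^(m * n), and objects living on them (maps, vector fields) are locally
   restrictions of smooth objects defined on open sets of the ambient space. *)

Section Smooth.
Context {R : realType} {V W : normedModType R}.

Fixpoint C_on (k : nat) (U : set V) (f : V -> W) : Prop :=
  if k is k'.+1 then
    (forall x, U x -> differentiable f x) /\
    (forall v : V, C_on k' U (fun x => 'D_v f x))
  else forall x, U x -> {for x, continuous f}.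

(* Only meaningful for U open and V finite dimensional. *)
Definition smooth_on (U : set V) (f : V -> W) : Prop :=
  forall k, C_on k U f.

End Smooth.

Section LinearAlgebra.
Context {R : realType} {V : vectType R}.

Definition lin_span (S : set V) : set V :=
  [set v | exists s : seq V, (forall x, x \in s -> S x) /\ v \in span s].

Definition has_dim (S : set V) (k : nat) : Prop :=
  exists2 U : {vspace V}, S = [set v | v \in U] & \dim U = k.

End LinearAlgebra.

Section Manifolds.
Context {R : realType} {m n : nat}.
Local Notation V := 'M[R]_(m.+1, n.+1).

(* Local defining functions: near each of its points, M is the zero set of
   c = dim V - k smooth functions with linearly independent differentials. *)
Definition submanifold (k : nat) (M : set V) : Prop :=
  forall p, M p -> exists (U : set V) (c : nat) (F : 'I_c -> V -> R),
    [/\ open U, U p, (c + k = m.+1 * n.+1)%N,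
        (forall i, smooth_on U (F i)) &
        (forall q, U q -> (M q <-> forall i, F i q = 0)) /\
        (forall q, U q -> forall a : 'I_c -> R,
           (forall v, \sum_i a i * 'd (F i) q v = 0) -> forall i, a i = 0)].

Definition tangent (M : set V) (p : V) : set V :=
  [set v | exists g : R -> V,
     [/\ g 0 = p, (\forall t \near (0 : R), M (g t)) & is_derive (0 : R) 1 g v]].

(* A distribution on M is given by its fibres D p for p in M; the values of D
   outside M are irrelevant. *)
Definition rank_distribution (k : nat) (M : set V) (D : V -> set V) : Prop :=
  forall p, M p -> exists (U : set V) (X : 'I_k -> V -> V),
    [/\ open U, U p, (forall i, smooth_on U (X i)) &
        forall q, U q -> M q ->
          [/\ D q `<=` tangent M q,
              free [seq X i q | i <- enum 'I_k] &
              D q = [set v | v \in span [seq X i q | i <- enum 'I_k]]]].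

Definition lie_bracket (X Y : V -> V) (p : V) : V :=
  'D_(X p) Y p - 'D_(Y p) X p.

Definition local_section (M : set V) (D : V -> set V) (U : set V)
    (X : V -> V) : Prop :=
  smooth_on U X /\ forall q, U q -> M q -> D q (X q).

(* The fibre at p of [D, D] + D. At points of M, the bracket of ambient fields
   tangent to M only depends on their restrictions to M. *)
Definition derived (M : set V) (D : V -> set V) (p : V) : set V :=
  lin_span (D p `|`
    [set v | exists (U : set V) (X Y : V -> V),
       [/\ open U, U p, local_section M D U X, local_section M D U Y &
           v = lie_bracket X Y p]]).

Definition derived_flag (M : set V) (D : V -> set V) (I : nat) : V -> set V :=
  iter I (derived M) D.

Definition distribution_235 (M : set V) (D : V -> set V) : Prop :=
  [/\ submanifold 5 M, rank_distribution 2 M D &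
      forall p, M p ->
        [/\ has_dim (derived_flag M D 0 p) 2,
            has_dim (derived_flag M D 1 p) 3 &
            has_dim (derived_flag M D 2 p) 5]].

End Manifolds.

Section Equivalence.
Context {R : realType}.

(* f restricts to a diffeomorphism from a neighbourhood of p in M1 onto an open
   subset of M2, with inverse g, and its differential maps D1 onto D2. *)
Definition local_equivalence_at {m1 n1 m2 n2 : nat}
    (M1 : set 'M[R]_(m1.+1, n1.+1))
    (D1 : 'M[R]_(m1.+1, n1.+1) -> set 'M[R]_(m1.+1, n1.+1))
    (M2 : set 'M[R]_(m2.+1, n2.+1))
    (D2 : 'M[R]_(m2.+1, n2.+1) -> set 'M[R]_(m2.+1, n2.+1))
    (p : 'M[R]_(m1.+1, n1.+1))
    (f : 'M[R]_(m1.+1, n1.+1) -> 'M[R]_(m2.+1, n2.+1)) : Prop :=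
  exists (U : set 'M[R]_(m1.+1, n1.+1)) (W : set 'M[R]_(m2.+1, n2.+1))
         (g : 'M[R]_(m2.+1, n2.+1) -> 'M[R]_(m1.+1, n1.+1)),
    [/\ [/\ open U, U p & open W],
        smooth_on U f /\ smooth_on W g,
        (forall q, (U `&` M1) q -> (W `&` M2) (f q) /\ g (f q) = q),
        (forall q, (W `&` M2) q -> (U `&` M1) (g q) /\ f (g q) = q) &
        forall q, (U `&` M1) q -> 'd f q @` D1 q = D2 (f q)].

Definition locally_equivalent {m1 n1 m2 n2 : nat}
    (M1 : set 'M[R]_(m1.+1, n1.+1))
    (D1 : 'M[R]_(m1.+1, n1.+1) -> set 'M[R]_(m1.+1, n1.+1))
    (M2 : set 'M[R]_(m2.+1, n2.+1))
    (D2 : 'M[R]_(m2.+1, n2.+1) -> set 'M[R]_(m2.+1, n2.+1)) : Prop :=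
  forall p, M1 p -> exists f, local_equivalence_at M1 D1 M2 D2 p f.

Definition homogeneous {m n : nat} (M : set 'M[R]_(m.+1, n.+1))
    (D : 'M[R]_(m.+1, n.+1) -> set 'M[R]_(m.+1, n.+1)) : Prop :=
  forall p, M p -> exists N : set 'M[R]_(m.+1, n.+1),
    [/\ open N, N p &
        forall q, N q -> M q ->
          exists f, local_equivalence_at M D M D p f /\ f p = q].

End Equivalence.

Section Ants.
Context {R : realType}.

(* R^6 is 'M[R]_(3, 2): row i of r is the i-th point (x_i, y_i), with rows
   numbered from 0; addition in 'I_3 is modulo 3. *)
Definition signed_area (r : 'M[R]_(3, 2)) : R :=
  2^-1 * \sum_(i : 'I_3) (r i 1 * r (i + 1) 0 - r i 0 * r (i + 1) 1).

Definition M_area (A : R) : set 'M[R]_(3, 2) := [set r | signed_area r = A].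

Definition Z_field (i : 'I_3) (r : 'M[R]_(3, 2)) : 'M[R]_(3, 2) :=
  \matrix_(j, k) if j == i then r (i + 1) k - r (i + 2) k else 0.

Definition D_ants (r : 'M[R]_(3, 2)) : set 'M[R]_(3, 2) :=
  [set v | v \in span [:: Z_field 0 r - Z_field 1 r;
                          Z_field 2 r - Z_field 0 r]].

End Ants.

Section Group.
Context {R : realType}.

Definition mx33 (s : seq (seq R)) : 'M[R]_3 :=
  \matrix_(i, j) nth 0 (nth [::] s i) j.

Definition SL2_R2 : set 'M[R]_3 :=
  [set h | exists a b x p q y : R,
     h = mx33 [:: [:: a; b; x]; [:: p; q; y]; [:: 0; 0; 1]] /\
     a * q - b * p = 1].

Definition E_mx : 6.-tuple 'M[R]_3 :=
  [tuple mx33 [:: [:: 0; 1; 0]; [:: 0; 0; 0]; [:: 0; 0; 0]];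
         mx33 [:: [:: 0; 0; 0]; [:: 1; 0; 0]; [:: 0; 0; 0]];
         mx33 [:: [:: 1; 0; 0]; [:: 0; -1; 0]; [:: 0; 0; 0]];
         mx33 [:: [:: 0; 0; 1]; [:: 0; 0; 0]; [:: 0; 0; 0]];
         mx33 [:: [:: 0; 0; 0]; [:: 0; 0; 1]; [:: 0; 0; 0]];
         mx33 [:: [:: 1; 0; 0]; [:: 0; 1; 0]; [:: 0; 0; 0]]].

(* tau i h H is the coefficient of E_i in h^-1 dh evaluated at the tangent
   vector H at h; it is well determined since the family E_mx is free. The
   index i is 1-based. *)
Definition tau (i : nat) (h H : 'M[R]_3) : R :=
  coord E_mx (inord i.-1) (invmx h *m H).

Definition theta1 (h H : 'M[R]_3) : R := tau 3 h H - tau 5 h H.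
Definition theta2 (h H : 'M[R]_3) : R := tau 4 h H + tau 5 h H.
Definition theta3 (h H : 'M[R]_3) : R := tau 1 h H - tau 2 h H - tau 3 h H.

Definition D_theta (h : 'M[R]_3) : set 'M[R]_3 :=
  [set H | [/\ tangent SL2_R2 h H,
               theta1 h H = 0, theta2 h H = 0 & theta3 h H = 0]].

End Group.

(* Main.v *)
(* The affine group SL(2,R) |x R^2 acts simply transitively on the triangles of
   area A, and the fields Z_i are invariant under this action. Hence the map
   sending a triangle r to the affine frame with origin r_0 and axes r_1 - r_0,
   r_2 - r_0, followed by a constant linear map which normalises the determinant
   from - 2 A to 1, carries D_ants to a left-invariant distribution on the
   group. Evaluating the Z_i in this frame gives exactly the kernel of theta^1,
   theta^2, theta^3. The map is the restriction of an affine map of the ambient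
   spaces with a linear left inverse, so that tangent spaces, brackets and
   derived flags are transported by its linear part; left translations give
   homogeneity in the same way.

   The growth vector is computed on triangles: with alpha_i (v) the component
   of v_i transverse to the edge opposite to r_i, the first derived distribution
   is the span of the Z_i, i.e. the common kernel of the alpha_i, and the second
   one is the kernel of their sum, which is proportional to the differential of
   the area. The upper bounds come from alpha ([X, Y]) = - d alpha (X, Y) for
   sections X, Y of a distribution tangent to the level set and killed by alpha;
   this only involves the values of X and Y at the point. *)
Require Import Defs.
From HB Require Import structures.
From mathcomp Require Import all_boot all_order all_algebra.
From mathcomp Require Import all_classical all_reals all_analysis.
From mathcomp Require Import ring lra.
Import Order.TTheory GRing.Theory Num.Theory.
Import numFieldNormedType.Exports.
Local Open Scope classical_set_scope.
Local Open Scope ring_scope.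

Set Implicit Arguments.
Unset Strict Implicit.
Unset Printing Implicit Defensive.

(** * Smooth functions *)

Section LinearMaps.
Context {R : realType}.

(** Finite dimension enters here: the map is a finite sum of coordinate functions times the fixed
    vectors [f (delta_mx i j)]. The general lemmas below take continuity of linear maps as a
    hypothesis. *)
Lemma mx_linear_continuous (m n : nat) (W : normedModType R)
  (f : {linear 'M[R]_(m, n) -> W}) : continuous f.
Proof.
have -> : (f : _ -> _) =
    \sum_i \sum_j (fun M : 'M[R]_(m, n) => M i j *: f (delta_mx i j)).
  apply/funext => M; rewrite [in LHS](matrix_sum_delta M) linear_sum fct_sumE.
  apply: eq_bigr => i _; rewrite linear_sum fct_sumE.
  by apply: eq_bigr => j _; rewrite linearZ.
move=> M; apply: differentiable_continuous.
apply: differentiable_sum => i; apply: differentiable_sum => j.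
exact/differentiableZl/differentiable_coord.
Qed.

Context {V W : normedModType R}.

Lemma is_diff_linear (f : {linear V -> W}) x : continuous f -> is_diff x f f.
Proof.
by move=> cf; apply: DiffDef; [exact: linear_differentiable|exact: diff_lin].
Qed.

Lemma is_diff_affine (f : {linear V -> W}) (b : W) x :
  continuous f -> is_diff x (fun y => f y + b) f.
Proof.
move=> cf; have df := is_diff_linear x cf.
have := is_diffD df (is_diff_cst b x).
by rewrite (_ : (f : V -> W) + 0 = f) // addr0.
Qed.

Lemma is_derive_diff (f df : V -> W) (x v : V) :
  is_diff x f df -> is_derive x v f (df v).
Proof.
move=> [dfx <-]; apply: DeriveDef; first exact: diff_derivable.
by rewrite deriveE.
Qed.

End LinearMaps.

Section SmoothCalculus.
Context {R : realType} {V : normedModType R}.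

Lemma is_derive_affine_comp {V' W W' : normedModType R}
    (L : {linear W -> W'}) (K : {linear V -> V'}) (b : V') (X : V' -> W) x v :
  continuous L -> continuous K -> differentiable X (K x + b) ->
  is_derive x v (fun y => L (X (K y + b))) (L ('D_(K v) X (K x + b))).
Proof.
move=> cL cK dX; rewrite deriveE//.
have dK := is_diff_affine b x cK.
have dX' : is_diff (K x + b) X ('d X (K x + b)) by apply: DiffDef.
have dL := is_diff_linear (X (K x + b)) cL.
exact: (is_derive_diff v (is_diff_comp (is_diff_comp dK dX') dL)).
Qed.

Lemma differentiable_affine_comp {V' W W' : normedModType R}
    (L : {linear W -> W'}) (K : {linear V -> V'}) (b : V') (X : V' -> W) x :
  continuous L -> continuous K -> differentiable X (K x + b) ->
  differentiable (fun y => L (X (K y + b))) x.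
Proof.
move=> cL cK dX; have dK := is_diff_affine b x cK.
have dX' : is_diff (K x + b) X ('d X (K x + b)) by apply: DiffDef.
have dL := is_diff_linear (X (K x + b)) cL.
by have [] := is_diff_comp (is_diff_comp dK dX') dL.
Qed.

Context {W : normedModType R}.
Implicit Types (U : set V) (f g : V -> W).

(** The first-order expansion of [f] at [x] is also one of [g], and [diff_unique] then identifies
    the differential of [g]. *)
Lemma near_eq_differentiable f g x :
  (\forall y \near x, f y = g y) -> differentiable f x -> differentiable g x.
Proof.
move=> fg /diff_locallyP[cdf dfE].
have gE : g \o shift x = cst (g x) + 'd f x +o_ 0 id.
  apply/eqaddoP => e e0; have /eqaddoP/(_ _ e0) := dfE.
  have fg0 : \forall h \near (0 : V), f (h + x) = g (h + x).
    by rewrite (near_shift 0 x) subr0 in fg.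
  apply: filterS2 fg0 => h fgh.
  by rewrite !fctE /= fgh (nbhs_singleton fg).
have d0 := diff_unique cdf gE.
by apply/diff_locallyP; rewrite d0.
Qed.

Lemma open_near_eq U f g x :
  open U -> {in U, f =1 g} -> U x -> \forall y \near x, f y = g y.
Proof.
move=> oU fg Ux; near=> y; apply: fg; rewrite inE.
by near: y; exact: open_nbhs_nbhs.
Unshelve. all: by end_near. Qed.

(** [C_on] recurses on derivatives defined on all of [V], whereas the rules of calculus give
    formulas for them at points of [U] only; this congruence lets the inductions below use those
    formulas. *)
Lemma C_on_eq k U f g : open U -> {in U, f =1 g} -> C_on k U f -> C_on k U g.
Proof.
move=> oU; elim: k f g => [|k IHk] f g fg /=.
  move=> cf x Ux; have nfg := open_near_eq oU fg Ux.
  have gx := nbhs_singleton nfg; rewrite /prop_for /continuous_at -gx.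
  by apply: cvg_trans (cf x Ux); exact: near_eq_cvg.
move=> [df Cf]; split=> [x Ux|v].
  exact: near_eq_differentiable (open_near_eq oU fg Ux) (df x Ux).
apply: IHk (Cf v) => x; rewrite inE => Ux.
exact: near_eq_derive (open_near_eq oU fg Ux).
Qed.

Lemma C_onW k U f : C_on k.+1 U f -> C_on k U f.
Proof.
elim: k f => [|k IHk] f /= [df Cf]; last by split=> // v; exact/IHk/Cf.
by move=> x Ux; exact/differentiable_continuous/df.
Qed.

Lemma C_onD k U f g : open U ->
  C_on k U f -> C_on k U g -> C_on k U (fun x => f x + g x).
Proof.
move=> oU; elim: k f g => [|k IHk] f g /=.
  by move=> cf cg x Ux; apply: cvgD; [exact: cf|exact: cg].
move=> [df Cf] [dg Cg]; split=> [x Ux|v].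
  by apply: differentiableD; [exact: df|exact: dg].
apply: C_on_eq (IHk _ _ (Cf v) (Cg v)) => // x; rewrite inE => Ux.
by rewrite -deriveD//; apply: diff_derivable; [exact: df|exact: dg].
Qed.

Lemma smooth_onD U f g : open U ->
  smooth_on U f -> smooth_on U g -> smooth_on U (fun x => f x + g x).
Proof. by move=> oU sf sg k; exact: C_onD. Qed.

Lemma smooth_on_cst U (w : W) : smooth_on U (fun=> w).
Proof.
move=> k; elim: k w => [|k IHk] w /=; first by move=> x _; exact: cst_continuous.
split=> [x _|v]; first exact: differentiable_cst.
rewrite [X in C_on k U X](_ : _ = fun=> 0); first exact: IHk.
by apply/funext => x; exact: derive_cst.
Qed.

Lemma smooth_on_linear U (f : {linear V -> W}) : continuous f -> smooth_on U f.
Proof.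
move=> cf [|k]; first by move=> x _; exact: cf.
split=> [x _|v]; first exact: linear_differentiable.
rewrite [X in C_on k U X](_ : _ = fun=> f v); first exact: smooth_on_cst.
apply/funext => x; rewrite deriveE; last exact: linear_differentiable.
by rewrite diff_lin.
Qed.

Lemma smooth_on_affine U (f : {linear V -> W}) (b : W) :
  open U -> continuous f -> smooth_on U (fun x => f x + b).
Proof.
by move=> oU cf; apply: smooth_onD => //; [exact: smooth_on_linear|exact: smooth_on_cst].
Qed.

Lemma smooth_on_differentiable U f x :
  smooth_on U f -> U x -> differentiable f x.
Proof. by move=> /(_ 1%N)[df _]; exact: df. Qed.

End SmoothCalculus.

(** Induction on the order with the Leibniz rule. The undifferentiated factors reappear at the lower
    order, which is why [C_onW] is called. *)
Lemma smooth_onM (R : realType) (V : normedModType R) (U : set V) (f g : V -> R) :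
  open U -> smooth_on U f -> smooth_on U g -> smooth_on U (fun x => f x * g x).
Proof.
move=> oU sf sg k; elim: k f g {sf sg}(sf k) (sg k) => [|k IHk] f g /=.
  by move=> cf cg x Ux; apply: cvgM; [exact: cf|exact: cg].
move=> Cf Cg; have [df Cf'] := Cf; have [dg Cg'] := Cg; split=> [x Ux|v].
  by apply: differentiableM; [exact: df|exact: dg].
apply: (@C_on_eq _ _ _ _ _ (fun x => f x * 'D_v g x + g x * 'D_v f x)) => //.
  move=> x; rewrite inE => Ux.
  by rewrite [RHS]deriveM//; apply: diff_derivable; [exact: df|exact: dg].
by apply: C_onD => //; apply: IHk => //; exact: C_onW.
Qed.

Section AffineChange.
Context {R : realType} {V V' W W' : normedModType R}.
Variables (L : {linear W -> W'}) (K : {linear V -> V'}) (b : V').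
Hypotheses (cL : continuous L) (cK : continuous K).

Lemma open_affine_preimage (U : set V') : open U -> open [set x | U (K x + b)].
Proof.
move=> oU; apply: (@open_comp _ _ (fun x => K x + b)) => // x _.
by apply: cvgD; [exact: cK|exact: cvg_cst].
Qed.

(** The derivative along [v] has the same shape, with [X] replaced by ['D_(K v) X], so the induction
    on the order closes on itself. *)
Lemma smooth_on_affine_comp (U : set V') (X : V' -> W) : open U ->
  smooth_on U X -> smooth_on [set x | U (K x + b)] (fun x => L (X (K x + b))).
Proof.
move=> oU sX k; elim: k X {sX}(sX k) => [|k IHk] X /=.
  move=> cX x Ux; apply: continuous_comp; last exact: cL.
  apply: (@continuous_comp _ _ _ (fun x => K x + b) X); last exact: cX.
  by apply: cvgD; [exact: cK|exact: cvg_cst].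
move=> [dX CX]; split=> [x Ux|v].
  by apply: differentiable_affine_comp => //; exact: dX.
apply: (C_on_eq (f := fun x => L ('D_(K v) X (K x + b)))).
- exact: open_affine_preimage.
- move=> x; rewrite inE /= => Ux; symmetry.
  have dXx := is_derive_affine_comp v cL cK (dX _ Ux).
  exact: derive_val.
- exact: IHk (CX (K v)).
Qed.

End AffineChange.

Section LinearChange.
Context {R : realType} {V V' W W' : normedModType R}.
Variables (L : {linear W -> W'}) (K : {linear V -> V'}).
Hypotheses (cL : continuous L) (cK : continuous K).

Lemma is_derive_linear_comp (X : V' -> W) x v : differentiable X (K x) ->
  is_derive x v (fun y => L (X (K y))) (L ('D_(K v) X (K x))).
Proof.
move=> dX; have := @is_derive_affine_comp _ _ _ _ _ L K 0 X x v cL cK.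
rewrite addr0 => /(_ dX); rewrite (_ : (fun y => _) = fun y => L (X (K y)))//.
by apply/funext => y; rewrite addr0.
Qed.

Lemma smooth_on_linear_comp (U : set V') (X : V' -> W) : open U ->
  smooth_on U X -> smooth_on (K @^-1` U) (fun x => L (X (K x))).
Proof.
move=> oU sX; have := @smooth_on_affine_comp _ _ _ _ _ L K 0 cL cK _ _ oU sX.
rewrite (_ : [set x | _] = K @^-1` U).
  rewrite (_ : (fun y => _) = fun y => L (X (K y)))//.
  by apply/funext => y; rewrite addr0.
by apply/seteqP; split=> x /=; rewrite addr0.
Qed.

End LinearChange.

(** * Images under affine maps *)

Section Curves.
Context {R : realType} {V W : normedModType R}.

Lemma is_derive_curve_comp (G : V -> W) (c : R -> V) (t : R) (v : V) :
  is_derive t 1 c v -> differentiable G (c t) ->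
  is_derive t 1 (G \o c) ('d G (c t) v).
Proof.
move=> [dc vE] dG; have dc' : differentiable c t by apply/derivable1_diffP.
have Dc := differentiableP dc'; have DG := differentiableP dG.
have -> : v = 'd c t 1 by rewrite -vE deriveE.
exact: (is_derive_diff _ (is_diff_comp Dc DG)).
Qed.

End Curves.

Section Tangent.
Context {R : realType} {m n : nat}.
Local Notation V := 'M[R]_(m.+1, n.+1).

(** Along a curve in [M] with velocity [v] the function [G] is constant near time 0, and the chain
    rule concludes. This is how equations valid on [M] become linear equations on tangent
    vectors. *)
Lemma derive_tangent (W : normedModType R) (M U : set V) (G : V -> W) (w : W)
    (p v : V) :
  open U -> U p -> differentiable G p ->
  (forall q, U q -> M q -> G q = w) -> tangent M p v -> 'D_v G p = 0.
Proof.
move=> oU Up dG Gw [c [c0 Mc dc]].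
have dGc : is_derive (0 : R) 1 (G \o c) ('d G p v).
  by rewrite -c0; apply: is_derive_curve_comp => //; rewrite c0.
have cc : {for (0 : R), continuous c}.
  by apply: differentiable_continuous; apply/derivable1_diffP; case: dc.
have Uc : \forall t \near (0 : R), U (c t).
  by apply: cc; rewrite /= c0; exact: open_nbhs_nbhs.
have Gcw : \forall t \near (0 : R), (G \o c) t = cst w t.
  by apply: filterS2 Uc Mc => t; exact: Gw.
by rewrite deriveE//; case: dGc => _ <-; rewrite (near_eq_derive _ Gcw) derive_cst.
Qed.

End Tangent.

Section TangentAffine.
Context {R : realType} {m1 n1 m2 n2 : nat}.
Local Notation V1 := 'M[R]_(m1.+1, n1.+1).
Local Notation V2 := 'M[R]_(m2.+1, n2.+1).

Lemma tangent_affine (M1 : set V1) (M2 : set V2) (L : {linear V1 -> V2})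
    (b : V2) (p v : V1) :
  (forall q, M1 q -> M2 (L q + b)) ->
  tangent M1 p v -> tangent M2 (L p + b) (L v).
Proof.
move=> M12 [c [c0 Mc dc]]; exists (fun t => L (c t) + b); split.
- by rewrite c0.
- by apply: filterS Mc => t; exact: M12.
- have cL := mx_linear_continuous (f := L).
  have dL := is_diff_affine b (c 0) cL.
  have [dLc dE] := dL; rewrite -(congr1 (@^~ v) dE).
  exact: is_derive_curve_comp.
Qed.

End TangentAffine.

Section AffineImage.
Context {R : realType} {m1 n1 m2 n2 : nat}.
Local Notation V1 := 'M[R]_(m1.+1, n1.+1).
Local Notation V2 := 'M[R]_(m2.+1, n2.+1).
Variables (M1 : set V1) (M2 : set V2).
Variables (L : {linear V1 -> V2}) (K : {linear V2 -> V1}) (b : V2).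
Hypotheses (LM : forall p, M1 p -> M2 (L p + b)).
Hypotheses (KM : forall q, M2 q -> M1 (K q)).
Hypotheses (LK : cancel L K) (Kb : K b = 0).
Hypotheses (KL : forall q, M2 q -> L (K q) + b = q).

Let f p := L p + b.

Let cL : continuous L. Proof. exact: mx_linear_continuous. Qed.
Let cK : continuous K. Proof. exact: mx_linear_continuous. Qed.

Let Kf p : K (f p) = p. Proof. by rewrite /f linearD LK Kb addr0. Qed.

(** Off [M2] nothing says that [L] inverts [K]. On [M2], however, [L (K q) - q] is the constant
    [- b], so its derivative along a tangent vector [w] vanishes, that is, [L (K w) = w]. *)
Lemma tangent_image p : M1 p -> tangent M2 (f p) = L @` tangent M1 p.
Proof.
move=> M1p; apply/seteqP; split=> [w Tw|_ [v Tv <-]]; last exact: (tangent_affine LM Tv).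
have TKw : tangent M1 p (K w).
  have := @tangent_affine _ _ _ _ _ M2 M1 K 0 _ _ _ Tw.
  by rewrite addr0 Kf; apply=> q M2q; rewrite addr0; exact: KM.
exists (K w) => //.
have dG : is_diff (f p) (fun q => L (K q) - q) (fun w => L (K w) - w).
  apply: is_diffB (is_diff_id _).
  exact: (is_diff_comp (is_diff_linear _ cK) (is_diff_linear _ cL)).
have [dGp _] := dG.
have : 'D_w (fun q => L (K q) - q) (f p) = 0.
  apply: (@derive_tangent _ _ _ _ M2 setT _ (- b)) => //; first exact: openT.
  by move=> q _ M2q; rewrite -[X in _ - X]KL// opprD addrA subrr add0r.
have [_ ->] := is_derive_diff w dG.
by move/eqP; rewrite subr_eq0 => /eqP.
Qed.

Variables (D1 : V1 -> set V1) (D2 : V2 -> set V2).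
Hypothesis D12 : forall p, M1 p -> D2 (f p) = L @` D1 p.

Lemma lin_span_image (S : set V1) : lin_span (L @` S) = L @` lin_span S.
Proof.
apply/seteqP; split=> [w [s [sS ws]]|_ [v [s [sS vs]] <-]].
  exists (K w).
    exists (map K s); split=> [_ /mapP[x xs ->]|].
      by have [y Sy <-] := sS _ xs; rewrite LK.
    have /(memv_img (linfun K)) := ws; rewrite limg_span lfunE /=.
    by rewrite (eq_map (lfunE K)).
  (* [L \o K] fixes every vector of [s], since these lie in the image of [L], hence it fixes their
     span. *)
  have : w \in lker (linfun (L \o K) - \1%VF).
    apply: (subvP _ _ ws); apply/span_subvP => x xs.
    have [y Sy <-] := sS _ xs.
    by rewrite memv_ker add_lfunE opp_lfunE id_lfunE lfunE /= LK subrr.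
  by rewrite memv_ker add_lfunE opp_lfunE id_lfunE lfunE subr_eq0 => /eqP.
exists (map L s); split=> [_ /mapP[x xs ->]|]; first by exists x => //; exact: sS.
have /(memv_img (linfun L)) := vs; rewrite limg_span lfunE /=.
by rewrite (eq_map (lfunE L)).
Qed.

Lemma has_dim_image (S : set V1) k : has_dim S k -> has_dim (L @` S) k.
Proof.
move=> [U -> <-]; exists (linfun L @: U)%VS.
  apply/seteqP; split=> [_ [v /= vU <-]|w /= /memv_imgP[v vU ->]] /=.
    by have := memv_img (linfun L) vU; rewrite lfunE.
  by exists v => //; rewrite lfunE.
apply: limg_dim_eq; apply/eqP; rewrite -subv0; apply/subvP => v.
rewrite memv_cap memv_ker lfunE memv0 /= => /andP[_ /eqP Lv].
by rewrite -(LK v) Lv linear0.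
Qed.

Lemma rank_distribution_image k :
  rank_distribution k M1 D1 -> rank_distribution k M2 D2.
Proof.
move=> rD q M2q; have [U [X [oU UKq sX XP]]] := rD _ (KM M2q).
exists (K @^-1` U), (fun i y => L (X i (K y))); split=> //.
- by apply: open_comp => // x _; exact: cK.
- by move=> i; exact: smooth_on_linear_comp.
move=> y Uy M2y; have [DT fX DE] := XP _ Uy (KM M2y).
have yE : y = f (K y) by rewrite /f KL.
have mapE : [seq L (X i (K y)) | i <- enum 'I_k] =
            map (linfun L) [seq X i (K y) | i <- enum 'I_k].
  by rewrite -[RHS]map_comp; apply: eq_map => i /=; rewrite lfunE.
have lkL : (lker (linfun L) == 0)%VS.
  rewrite -subv0; apply/subvP => v; rewrite memv_ker lfunE memv0 /= => /eqP Lv.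
  by rewrite -(LK v) Lv linear0.
split.
- by rewrite yE D12 ?tangent_image//; [exact: image_subset|exact: KM..].
- move: fX; rewrite mapE /free !size_map -limg_span limg_dim_eq//.
  by rewrite (eqP lkL) capv0.
- rewrite [in LHS]yE D12; last exact: KM.
  rewrite DE mapE -limg_span; apply/seteqP.
  split=> [_ [v /= vU <-]|w /= /memv_imgP[v vU ->]] /=.
    by have := memv_img (linfun L) vU; rewrite lfunE.
  by exists v => //; rewrite lfunE.
Qed.

(** Sections are pushed forward as [L (X (K q))] and pulled back as [K (X (f q))]. Pushing forward
    is the chain rule, since [K] undoes [L]; pulling back needs [L (K w) = w] for the values of
    sections of [D2] and for their derivatives along [D2]. *)
Lemma derived_image p : (forall q, M1 q -> D1 q `<=` tangent M1 q) ->
  M1 p -> derived M2 D2 (f p) = L @` derived M1 D1 p.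
Proof.
move=> DT M1p; rewrite /derived -lin_span_image image_setU D12//; congr (lin_span (_ `|` _)).
apply/seteqP; split=> [w|_ [v [U [X [Y [oU Up [sX DX] [sY DY] vE]]]] <-]].
  move=> [U [X [Y [oU Up [sX DX] [sY DY] wE]]]].
  have dX := smooth_on_differentiable sX Up.
  have dY := smooth_on_differentiable sY Up.
  have LKD q Z : M1 q -> D2 (f q) Z -> L (K Z) = Z.
    by move=> M1q; rewrite D12// => -[u _ <-]; rewrite LK.
  (* On [M2] near [f p] the function [L (K (Z1 q)) - Z1 q] is zero, because [Z1] takes values in the
     image of [L]. Differentiating it along the tangent vector [Z2 (f p)] gives the claim; tangency
     comes from [DT]. *)
  have bracketE (Z1 Z2 : V2 -> V2) : smooth_on U Z1 -> 
      (forall q, U q -> M2 q -> D2 q (Z1 q)) ->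
      (forall q, U q -> M2 q -> D2 q (Z2 q)) ->
      L (K ('D_(Z2 (f p)) Z1 (f p))) = 'D_(Z2 (f p)) Z1 (f p).
    move=> sZ1 DZ1 DZ2; have dZ := smooth_on_differentiable sZ1 Up.
    have TZ2 : tangent M2 (f p) (Z2 (f p)).
      have := DZ2 _ Up (LM M1p); rewrite D12// tangent_image//.
      by apply: image_subset; exact: DT.
    have DZ := differentiableP dZ.
    have DLK := is_diff_comp (is_diff_comp DZ (is_diff_linear (Z1 (f p)) cK))
      (is_diff_linear (K (Z1 (f p))) cL).
    have dG := is_diffB DLK DZ; have [dGp _] := dG.
    have := derive_tangent (w := 0) oU Up dGp _ TZ2.
    have [_ ->] := is_derive_diff (Z2 (f p)) dG.
    rewrite deriveE// => /(_ _)/eqP; rewrite subr_eq0 => H; apply/eqP/H.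
    move=> q Uq M2q; apply/eqP; rewrite subr_eq0 /=; apply/eqP.
    rewrite -[q in Z1 q](KL M2q) in DZ1 *.
    apply: (@LKD (K q)); first exact: KM.
    by rewrite /f KL//; exact: DZ1.
  have DKE (Z1 Z2 : V2 -> V2) : smooth_on U Z1 -> 
      (forall q, U q -> M2 q -> D2 q (Z2 q)) ->
     'D_(K (Z2 (f p))) (fun q => K (Z1 (f q))) p = K ('D_(Z2 (f p)) Z1 (f p)).
    move=> sZ1 DZ2; have dZ := smooth_on_differentiable sZ1 Up.
    have [_ ->] := is_derive_affine_comp (K (Z2 (f p))) cK cL dZ.
    by rewrite (@LKD p)//; apply: DZ2 => //; exact: LM.
  have sK Z : smooth_on U Z -> smooth_on (f @^-1` U) (fun q => K (Z (f q))).
    exact: smooth_on_affine_comp.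
  have DK Z : (forall q, U q -> M2 q -> D2 q (Z q)) ->
      forall q, (f @^-1` U) q -> M1 q -> D1 q (K (Z (f q))).
    move=> DZ q Uq M1q; have := DZ _ Uq (LM M1q).
    by rewrite [D2 _]D12// => -[u Du <-]; rewrite LK.
  exists (K w); last by rewrite wE /lie_bracket !linearB/= !bracketE.
  exists (f @^-1` U), (fun q => K (X (f q))), (fun q => K (Y (f q))); split=> //.
  - exact: open_affine_preimage.
  - by split; [exact: sK|exact: DK].
  - by split; [exact: sK|exact: DK].
  - by rewrite wE /lie_bracket linearB/= !DKE.
have sL Z : smooth_on U Z -> smooth_on (K @^-1` U) (fun q => L (Z (K q))).
  exact: smooth_on_linear_comp.
have DL Z : (forall q, U q -> M1 q -> D1 q (Z q)) ->
    forall q, (K @^-1` U) q -> M2 q -> D2 q (L (Z (K q))).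
  move=> DZ q Uq M2q; rewrite -[in D2 q](KL M2q) [D2 _]D12; last exact: KM.
  by exists (Z (K q)) => //; apply: DZ => //; exact: KM.
have DLE (Z1 Z2 : V1 -> V1) : smooth_on U Z1 ->
    'D_(L (Z2 p)) (fun q => L (Z1 (K q))) (f p) = L ('D_(Z2 p) Z1 p).
  move=> sZ; have dZ : differentiable Z1 (K (f p)).
    by rewrite Kf; exact: smooth_on_differentiable sZ Up.
  have [_ ->] := is_derive_linear_comp cL cK (L (Z2 p)) dZ.
  by rewrite LK Kf.
exists (K @^-1` U), (fun q => L (X (K q))), (fun q => L (Y (K q))); split=> //.
- by apply: open_comp => // x _; exact: cK.
- by rewrite /preimage/= Kf.
- by split; [exact: sL|exact: DL].
- by split; [exact: sL|exact: DL].
- by rewrite vE /lie_bracket !Kf linearB/= !DLE.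
Qed.

Lemma affine_local_equivalence p : M1 p -> local_equivalence_at M1 D1 M2 D2 p f.
Proof.
move=> M1p; exists setT, setT, K; split.
- by split=> //; exact: openT.
- split; first by apply: smooth_on_affine => //; exact: openT.
  exact: smooth_on_linear.
- by move=> q [_ M1q]; split; [split=> //; exact: LM|exact: Kf].
- by move=> q [_ M2q]; split; [split=> //; exact: KM|exact: KL].
- by move=> q [_ M1q]; rewrite D12//; have [_ ->] := is_diff_affine b q cL.
Qed.

End AffineImage.

(** [derived_image] is applied to [D1] and then to [derived M1 D1]. Tangency of [D1] is part of
    being a rank distribution, while tangency of the derived distribution is assumed separately. *)
Lemma distribution_235_image (R : realType) (m1 n1 m2 n2 : nat)
    (M1 : set 'M[R]_(m1.+1, n1.+1)) (M2 : set 'M[R]_(m2.+1, n2.+1))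
    (L : {linear 'M[R]_(m1.+1, n1.+1) -> 'M[R]_(m2.+1, n2.+1)})
    (K : {linear 'M[R]_(m2.+1, n2.+1) -> 'M[R]_(m1.+1, n1.+1)})
    (b : 'M[R]_(m2.+1, n2.+1)) D1 D2 :
  (forall p, M1 p -> M2 (L p + b)) -> (forall q, M2 q -> M1 (K q)) ->
  cancel L K -> K b = 0 -> (forall q, M2 q -> L (K q) + b = q) ->
  (forall p, M1 p -> D2 (L p + b) = L @` D1 p) ->
  (forall p, M1 p -> derived M1 D1 p `<=` tangent M1 p) ->
  submanifold 5 M2 -> distribution_235 M1 D1 -> distribution_235 M2 D2.
Proof.
move=> LM KM LK Kb KL D12 D1T sM2 [sM1 rD1 flagD1].
have D0T p : M1 p -> D1 p `<=` tangent M1 p.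
  by move=> M1p; have [U [X [_ Up _ /(_ p Up M1p)[]]]] := rD1 p M1p.
have D12' p : M1 p -> derived M2 D2 (L p + b) = L @` derived M1 D1 p.
  exact: (derived_image LM KM LK Kb KL D12 D0T).
have D12'' p : M1 p ->
    derived M2 (derived M2 D2) (L p + b) = L @` derived M1 (derived M1 D1) p.
  exact: (derived_image LM KM LK Kb KL D12' D1T).
split=> //; first exact: (rank_distribution_image LM KM LK Kb KL D12).
move=> q M2q; rewrite -(KL q M2q) /derived_flag /=.
have M1q := KM q M2q; rewrite D12// D12'// D12''//.
by have [? ? ?] := flagD1 _ M1q; split; apply: (has_dim_image LK).
Qed.

(** * Auxiliary facts on matrix-valued maps, spans and small index sets *)

Section MatrixDerivatives.
Context {R : realType}.

Lemma is_derive_coord (V : normedModType R) m n (Y : V -> 'M[R]_(m, n))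
    (x v : V) (dY : 'M[R]_(m, n)) i j :
  is_derive x v Y dY -> is_derive x v (fun y => Y y i j) (dY i j).
Proof.
move=> [dYx <-]; apply: DeriveDef; first by move/derivable_mxP: dYx; exact.
by rewrite derive_mx// mxE.
Qed.

Lemma is_derive_mx (V : normedModType R) m n (Y : V -> 'M[R]_(m, n))
    (x v : V) (dY : 'M[R]_(m, n)) :
  (forall i j, is_derive x v (fun y => Y y i j) (dY i j)) -> is_derive x v Y dY.
Proof.
move=> dYx; have dY' : derivable Y x v by apply/derivable_mxP => i j; case: (dYx i j).
apply: DeriveDef => //; rewrite derive_mx//; apply/matrixP => i j; rewrite mxE.
by case: (dYx i j).
Qed.

(** Gives the initial velocity of the polynomial curves built in [Zs_tangent]. *)
Lemma is_derive_cubic (a0 a1 a2 a3 : R) : is_derive (0 : R) 1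
  (fun t : R => a0 + t * a1 + t ^+ 2 * a2 + t ^+ 3 * a3) a1.
Proof.
have -> : (fun t : R => a0 + t * a1 + t ^+ 2 * a2 + t ^+ 3 * a3) =
   cst a0 + id * cst a1 + id ^+ 2 * cst a2 + id ^+ 3 * cst a3.
  by apply/funext => t; rewrite !fctE.
apply: is_derive_eq; rewrite /= !fctE.
by rewrite /GRing.scale /=; ring.
Qed.

End MatrixDerivatives.

Section Span.
Context {K : fieldType} {V : vectType K}.
Implicit Types u v w x : V.

Lemma span2P u v x :
  reflect (exists c d, x = c *: u + d *: v) (x \in <<[:: u; v]>>%VS).
Proof.
rewrite span_cons span_seq1; apply: (iffP memv_addP).
  by move=> [_ /vlineP[c ->] [_ /vlineP[d ->] ->]]; exists c, d.
move=> [c [d ->]]; exists (c *: u); first by rewrite memvZ// memv_line.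
by exists (d *: v) => //; rewrite memvZ// memv_line.
Qed.

Lemma span3P u v w x :
  reflect (exists c d e, x = c *: u + d *: v + e *: w) (x \in <<[:: u; v; w]>>%VS).
Proof.
rewrite span_cons; apply: (iffP memv_addP).
  by move=> [_ /vlineP[c ->] [_ /span2P[d [e ->]] ->]]; exists c, d, e; rewrite addrA.
move=> [c [d [e ->]]]; exists (c *: u); first by rewrite memvZ// memv_line.
by exists (d *: v + e *: w); [apply/span2P; exists d, e|rewrite addrA].
Qed.

End Span.

Lemma lin_span_eq (R : realType) (V : vectType R) (S : set V) (U : {vspace V}) s :
  (forall v, S v -> v \in U) -> (forall v, v \in s -> S v) ->
  (U <= span s)%VS -> lin_span S = [set v | v \in U].
Proof.
move=> SU sS Us; apply/seteqP; split=> [v [t [tS vt]]|v /= vU].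
  by apply: (subvP _ _ vt); apply/span_subvP => x xt; exact/SU/tS.
by exists s; split=> //; exact: (subvP Us).
Qed.

(** Case analysis that produces the numerals in which the entry lemmas below are stated. *)
Lemma ord3P (P : 'I_3 -> Prop) : P 0 -> P 1 -> P 2 -> forall i, P i.
Proof.
move=> P0 P1 P2 [[|[|[|//]]] lti].
- by rewrite (_ : Ordinal lti = 0)//; exact: val_inj.
- by rewrite (_ : Ordinal lti = 1)//; exact: val_inj.
- by rewrite (_ : Ordinal lti = 2)//; exact: val_inj.
Qed.

Lemma ord2P (P : 'I_2 -> Prop) : P 0 -> P 1 -> forall i, P i.
Proof.
move=> P0 P1 [[|[|//]] lti].
- by rewrite (_ : Ordinal lti = 0)//; exact: val_inj.
- by rewrite (_ : Ordinal lti = 1)//; exact: val_inj.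
Qed.

(** * The ants *)

Section AntFields.
Context {R : realType}.
Implicit Types (r v w : 'M[R]_(3, 2)).

Lemma signed_areaE r : signed_area r = 2^-1 *
  ((r 0 1 * r 1 0 - r 0 0 * r 1 1) + (r 1 1 * r 2 0 - r 1 0 * r 2 1) +
   (r 2 1 * r 0 0 - r 2 0 * r 0 1)).
Proof.
have o1 : lift ord0 ord0 = 1 :> 'I_3 by exact: val_inj.
have o2 : lift ord0 (lift ord0 ord0) = 2 :> 'I_3 by exact: val_inj.
have o21 : 2 + 1 = 0 :> 'I_3 by exact: val_inj.
by rewrite /signed_area !big_ord_recl big_ord0 addr0 o1 o2 o21 add0r !addrA.
Qed.

Lemma Z_fieldE r k :
  (Z_field 0 r 0 k = r 1 k - r 2 k) * (Z_field 0 r 1 k = 0) *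
  (Z_field 0 r 2 k = 0) * (Z_field 1 r 0 k = 0) *
  (Z_field 1 r 1 k = r 2 k - r 0 k) * (Z_field 1 r 2 k = 0) *
  (Z_field 2 r 0 k = 0) * (Z_field 2 r 1 k = 0) *
  (Z_field 2 r 2 k = r 0 k - r 1 k).
Proof.
have o21 : 2 + 1 = 0 :> 'I_3 by exact: val_inj.
have o12 : 1 + 2 = 0 :> 'I_3 by exact: val_inj.
have o22 : 2 + 2 = 1 :> 'I_3 by exact: val_inj.
by do !split; rewrite mxE//= ?add0r ?o21 ?o12 ?o22.
Qed.

(** Linearity in the point turns brackets of these fields into commutators of linear maps. *)
Lemma Z_field_linear i : linear (@Z_field R i).
Proof.
move=> a u v; apply/matrixP => j k; rewrite !mxE; case: ifP => _; first by ring.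
by rewrite mulr0 addr0.
Qed.
HB.instance Definition _ i :=
  GRing.isLinear.Build R 'M[R]_(3, 2) 'M[R]_(3, 2) *:%R (@Z_field R i)
    (Z_field_linear i).

(* [alpha i r] is the 1-form which measures the component of the velocity of
   the ant [i] transverse to the opposite edge. *)
Definition alpha (i : 'I_3) r v : R :=
  v i 0 * (r (i + 1) 1 - r (i + 2) 1) - v i 1 * (r (i + 1) 0 - r (i + 2) 0).

Lemma alphaE r v :
  (alpha 0 r v = v 0 0 * (r 1 1 - r 2 1) - v 0 1 * (r 1 0 - r 2 0)) *
  (alpha 1 r v = v 1 0 * (r 2 1 - r 0 1) - v 1 1 * (r 2 0 - r 0 0)) *
  (alpha 2 r v = v 2 0 * (r 0 1 - r 1 1) - v 2 1 * (r 0 0 - r 1 0)).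
Proof.
have o21 : 2 + 1 = 0 :> 'I_3 by exact: val_inj.
have o12 : 1 + 2 = 0 :> 'I_3 by exact: val_inj.
have o22 : 2 + 2 = 1 :> 'I_3 by exact: val_inj.
by rewrite /alpha !add0r o21 o12 o22.
Qed.

(** [alpha i] is bilinear in the point and the vector, so each argument contributes one term. *)
Lemma is_derive_alpha i (Y : 'M[R]_(3, 2) -> 'M[R]_(3, 2)) p v :
  differentiable Y p ->
  is_derive p v (fun q => alpha i q (Y q)) (alpha i v (Y p) + alpha i p ('D_v Y p)).
Proof.
move=> dY; have DY j k : is_derive p v (fun q => Y q j k) ('D_v Y p j k).
  by apply: is_derive_coord; apply: DeriveDef => //; exact: diff_derivable.
have DX j k : is_derive p v (fun q : 'M[R]_(3, 2) => q j k) (v j k).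
  by apply: is_derive_coord; exact: is_derive_id.
have DB k : is_derive p v (fun q : 'M[R]_(3, 2) => q (i + 1) k - q (i + 2) k)
    (v (i + 1) k - v (i + 2) k).
  exact: is_deriveB.
have H := is_deriveB (is_deriveM (DY i 0) (DB 1)) (is_deriveM (DY i 1) (DB 0)).
apply: (is_derive_eq H).
rewrite /alpha /= /GRing.scale /=; ring.
Qed.

Lemma is_derive_signed_area p v :
  is_derive p v (@signed_area R) (- 2^-1 * \sum_i alpha i p v).
Proof.
have DX j k : is_derive p v (fun q : 'M[R]_(3, 2) => q j k) (v j k).
  by apply: is_derive_coord; exact: is_derive_id.
have -> : @signed_area R = (2^-1 \*: 
  (((fun q => q 0 1) * (fun q => q 1 0) - (fun q => q 0 0) * (fun q => q 1 1)) + 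
   ((fun q => q 1 1) * (fun q => q 2 0) - (fun q => q 1 0) * (fun q => q 2 1)) +
   ((fun q => q 2 1) * (fun q => q 0 0) - (fun q => q 2 0) * (fun q => q 0 1)))).
  by apply/funext => q; rewrite signed_areaE.
apply: is_derive_eq.
rewrite !big_ord_recl big_ord0.
rewrite (_ : lift ord0 ord0 = 1); last exact: val_inj.
rewrite (_ : lift ord0 _ = 2); last exact: val_inj.
rewrite !alphaE /GRing.scale /=; ring.
Qed.

End AntFields.

Lemma smooth_on_coord (R : realType) m n (U : set 'M[R]_(m.+1, n.+1)) i j :
  smooth_on U (fun q => q i j).
Proof.
move=> [|k]; first by move=> x _; exact: coord_continuous.
split=> [x _|v]; first exact: differentiable_coord.
rewrite [X in C_on k U X](_ : _ = fun=> v i j); first exact: smooth_on_cst.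
by apply/funext => x; have [] := is_derive_coord i j (is_derive_id x v).
Qed.

Lemma smooth_onN (R : realType) (V : normedModType R) (U : set V) (f : V -> R) :
  open U -> smooth_on U f -> smooth_on U (fun x => - f x).
Proof.
move=> oU sf; rewrite (_ : (fun x => _) = fun x => -1 * f x).
  by apply: smooth_onM => //; exact: smooth_on_cst.
by apply/funext => x; rewrite mulN1r.
Qed.

(** Cramer's rule: in the basis [e], [f] of the plane, the coefficient of [v] along [f] is zero and
    the one along [e] is the quotient of determinants given as witness. *)
Lemma parallelP (F : fieldType) (v1 v2 e1 e2 f1 f2 : F) :
  e1 * f2 - e2 * f1 != 0 -> v1 * e2 - v2 * e1 = 0 ->
  exists c, v1 = c * e1 /\ v2 = c * e2.
Proof.
move=> d0 ve; exists ((v1 * f2 - v2 * f1) / (e1 * f2 - e2 * f1)).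
split; apply: (mulIf d0); rewrite mulrAC divfK//; apply/eqP; rewrite -subr_eq0.
  by apply/eqP; rewrite -[RHS](mulr0 (- f1)) -ve; ring.
by apply/eqP; rewrite -[RHS](mulr0 (- f2)) -ve; ring.
Qed.

Section Entries.
Context {R : pzRingType} {m n : nat}.
Implicit Types u v : 'M[R]_(m, n).

(** Unlike [mxE], these three rules do not unfold [Z_field], so that [Z_fieldE] still applies
    afterwards. *)
Lemma mxDE u v i j : (u + v) i j = u i j + v i j. Proof. by rewrite mxE. Qed.
Lemma mxNE u i j : (- u) i j = - u i j. Proof. by rewrite mxE. Qed.
Lemma mxZE a u i j : (a *: u) i j = a * u i j. Proof. by rewrite mxE. Qed.

End Entries.

Section LinearFields.
Context {R : realType} {m n : nat}.
Local Notation V := 'M[R]_(m.+1, n.+1).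

Lemma lie_bracket_linear (X Y : {linear V -> V}) p :
  lie_bracket X Y p = Y (X p) - X (Y p).
Proof.
have dL (L : {linear V -> V}) v : 'D_v L p = L v.
  have dL : is_diff p L L by apply: is_diff_linear; exact: mx_linear_continuous.
  by have [] := is_derive_diff v dL.
by rewrite /lie_bracket !dL.
Qed.

Lemma smooth_on_mx_linear (U : set V) (X : {linear V -> V}) : smooth_on U X.
Proof. by apply: smooth_on_linear; exact: mx_linear_continuous. Qed.

Lemma lie_bracket_derived (M : set V) (D : V -> set V) (X Y : {linear V -> V}) p :
  (forall q, M q -> D q (X q)) -> (forall q, M q -> D q (Y q)) ->
  [set v | exists (U : set V) (X Y : V -> V),
     [/\ open U, U p, local_section M D U X, local_section M D U Y &
         v = lie_bracket X Y p]] (Y (X p) - X (Y p)).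
Proof.
move=> DX DY; exists setT, X, Y; split=> //; first exact: openT.
- by split=> [|q _]; [exact: smooth_on_mx_linear|exact: DX].
- by split=> [|q _]; [exact: smooth_on_mx_linear|exact: DY].
- by rewrite lie_bracket_linear.
Qed.

End LinearFields.

(** * The growth vector of the ant distribution *)

Section AntDistribution.
Context {R : realType}.
Implicit Types (r p q v w : 'M[R]_(3, 2)) (A : R).

Lemma smooth_on_signed_area (U : set 'M[R]_(3, 2)) :
  open U -> smooth_on U (@signed_area R).
Proof.
move=> oU; rewrite (funext signed_areaE).
apply: smooth_onM => //; first exact: smooth_on_cst.
by do ?[exact: smooth_on_coord|apply: smooth_onM => //|apply: smooth_onN => //|
  apply: smooth_onD => //].
Qed.

Lemma sum_alpha r v : \sum_i alpha i r v = alpha 0 r v + alpha 1 r v + alpha 2 r v.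
Proof.
rewrite !big_ord_recl big_ord0 addr0 addrA.
by congr (_ + alpha _ _ _ + alpha _ _ _); exact: val_inj.
Qed.

(** The area is a quadratic form and this sum is a multiple of its polar form. By this symmetry the
    sum kills brackets of sections of the derived distribution. *)
Lemma sum_alphaC r v : \sum_i alpha i r v = \sum_i alpha i v r.
Proof. rewrite !sum_alpha !alphaE; ring. Qed.

Lemma sum_alpha_self r : \sum_i alpha i r r = - 4 * signed_area r.
Proof. by rewrite sum_alpha !alphaE signed_areaE; field. Qed.

(** The area is homogeneous of degree 2, so by Euler's identity [sum_alpha_self] its differential at
    [q], evaluated at [q] itself, is nonzero wherever the area is. *)
Lemma submanifold_M_area A : A != 0 -> submanifold 5 (M_area A).
Proof.
move=> A0 p Mp; exists [set q | signed_area q != 0], 1%N, (fun=> fun q => signed_area q - A).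
have cA : continuous (@signed_area R).
  by move=> q; have := smooth_on_signed_area openT 0%N; exact.
have oU : open [set q | signed_area q != 0 :> R].
  apply: (@open_comp _ _ (@signed_area R) [set x | x != 0]) => [q _|]; first exact: cA.
  exact: open_neq.
split=> //.
- by rewrite /= (Mp : _ = _).
- by move=> _; apply: smooth_onD => //; [exact: smooth_on_signed_area|exact: smooth_on_cst].
- split=> q Uq.
    split=> [Mq _|/(_ 0)/eqP]; first by rewrite (Mq : _ = _) subrr.
    by rewrite subr_eq0 => /eqP.
  move=> a /(_ q) + i; rewrite big_ord_recl big_ord0 addr0 (ord1 i) => aE.
  have dA : differentiable (@signed_area R) q.
    exact: smooth_on_differentiable (smooth_on_signed_area openT) _.
  have := is_diffB (differentiableP dA) (is_diff_cst A q).
  move=> [_ dE]; have {}dE : 'd (fun q => signed_area q - A) q q = 'd (@signed_area R) q q.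
    by rewrite [LHS](congr1 (@^~ q) dE) /= [LHS]subr0.
  move: aE; rewrite dE -deriveE//; have [_ ->] := is_derive_signed_area q q.
  rewrite sum_alpha_self => aE; apply: (mulIf Uq); rewrite mul0r.
  by rewrite -[RHS](mulr0 2^-1) -aE; field.
Qed.

Definition Zs r := [:: Z_field 0 r; Z_field 1 r; Z_field 2 r].

Lemma Z_combE a b c r k :
  ((a *: Z_field 0 r + b *: Z_field 1 r + c *: Z_field 2 r) 0 k =
     a * (r 1 k - r 2 k)) *
  ((a *: Z_field 0 r + b *: Z_field 1 r + c *: Z_field 2 r) 1 k =
     b * (r 2 k - r 0 k)) *
  ((a *: Z_field 0 r + b *: Z_field 1 r + c *: Z_field 2 r) 2 k =
     c * (r 0 k - r 1 k)).
Proof.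
have E i : (a *: Z_field 0 r + b *: Z_field 1 r + c *: Z_field 2 r) i k =
    a * Z_field 0 r i k + b * Z_field 1 r i k + c * Z_field 2 r i k.
  by move: (Z_field 0 r) (Z_field 1 r) (Z_field 2 r) => ? ? ?; rewrite !mxE.
by rewrite !E !Z_fieldE !mulr0 !addr0 !add0r.
Qed.

(** All three determinants of consecutive edges equal [- 2 * signed_area r]. *)
Lemma edge_det r : signed_area r != 0 ->
  [/\ (r 1 0 - r 2 0) * (r 2 1 - r 0 1) - (r 1 1 - r 2 1) * (r 2 0 - r 0 0) != 0,
      (r 2 0 - r 0 0) * (r 0 1 - r 1 1) - (r 2 1 - r 0 1) * (r 0 0 - r 1 0) != 0 &
      (r 0 0 - r 1 0) * (r 1 1 - r 2 1) - (r 0 1 - r 1 1) * (r 1 0 - r 2 0) != 0].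
Proof.
move=> r0; have d0 : - 2 * signed_area r != 0.
  by rewrite mulf_neq0// oppr_eq0 pnatr_eq0.
by split; apply: contra_neq d0 => dE; rewrite -dE signed_areaE; field.
Qed.

(** The velocity of each ant is parallel to the opposite edge; [parallelP] extracts the factor, with
    the next edge as auxiliary vector. *)
Lemma mem_span_Zs r v : signed_area r != 0 ->
  (forall i, alpha i r v = 0) -> v \in <<Zs r>>%VS.
Proof.
move=> /edge_det[d0 d1 d2] av; apply/span3P.
have := av 0; have := av 1; have := av 2; rewrite !alphaE => a2 a1 a0.
have [a [v00 v01]] := parallelP d0 a0; have [b [v10 v11]] := parallelP d1 a1.
have [c [v20 v21]] := parallelP d2 a2; exists a, b, c.
by apply/matrixP; apply: ord3P; apply: ord2P; rewrite !Z_combE.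
Qed.

Lemma alpha_Zs i r v : v \in <<Zs r>>%VS -> alpha i r v = 0.
Proof.
move=> /span3P[a [b [c ->]]]; move: i.
by apply: ord3P; rewrite !alphaE !Z_combE; ring.
Qed.

(** Among the combinations of the [Z_field i], these are the ones whose coefficients add up to
    zero. *)
Lemma D_antsP r v : D_ants r v <-> exists a b,
  v = (a - b) *: Z_field 0 r + (- a) *: Z_field 1 r + b *: Z_field 2 r.
Proof.
have E a b : a *: (Z_field 0 r - Z_field 1 r) + b *: (Z_field 2 r - Z_field 0 r) =
    (a - b) *: Z_field 0 r + (- a) *: Z_field 1 r + b *: Z_field 2 r.
  move: (Z_field 0 r) (Z_field 1 r) (Z_field 2 r) => x y z.
  by apply/matrixP => i j; rewrite !mxE; ring.
split=> [/span2P[a [b ->]]|[a [b ->]]]; first by exists a, b.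
by apply/span2P; exists a, b.
Qed.

Lemma D_ants_Zs r v : D_ants r v -> v \in <<Zs r>>%VS.
Proof. by move=> /D_antsP[a [b ->]]; apply/span3P; do 3!eexists. Qed.

(* Moving one ant at a time parallel to the opposite edge keeps the area
   constant. *)
Lemma Zs_tangent A p v :
  M_area A p -> v \in <<Zs p>>%VS -> tangent (M_area A) p v.
Proof.
move=> Mp /span3P[a [b [c vE]]].
pose e0 k := p 1 k - p 2 k; pose e1 k := p 2 k - p 0 k.
(* Ants 0, 1, 2 move in turn, each parallel to the opposite edge as already displaced by the
   previous moves. [w2] and [w3] collect the terms of order 2 and 3 in time. *)
pose w2 (i : 'I_3) k := if i == 1 then - (b * (a * e0 k))
  else if i == 2 then c * (a * e0 k - b * e1 k) else 0.
pose w3 (i : 'I_3) k := if i == 2 then c * (b * (a * e0 k)) else 0.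
exists (fun t => \matrix_(i, k) (p i k + t * v i k + t ^+ 2 * w2 i k + t ^+ 3 * w3 i k)).
split.
- apply/matrixP => i k; rewrite mxE !mul0r !expr0n /= !mul0r; ring.
- near=> t; rewrite /M_area /= -(Mp : _ = _) !signed_areaE !mxE vE !Z_combE.
  rewrite /w2 /w3 /e0 /e1 /=; ring.
- apply: is_derive_mx => i k; under eq_fun do rewrite mxE.
  exact: is_derive_cubic.
Unshelve. all: by end_near. Qed.

(** The function [alpha i q (Y q)] vanishes on the level set near [p]; differentiating it along the
    tangent vector [X p] expresses [alpha i] of the derivative through the values at [p], and
    likewise with [X] and [Y] exchanged. [D] is kept general to cover both [D_ants] and its derived
    distribution. *)
Lemma alpha_bracket A (D : 'M[R]_(3, 2) -> set 'M[R]_(3, 2)) U X Y p i :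
  (forall q v, M_area A q -> D q v -> v \in <<Zs q>>%VS) ->
  open U -> U p -> M_area A p ->
  local_section (M_area A) D U X -> local_section (M_area A) D U Y ->
  alpha i p (lie_bracket X Y p) = alpha i (Y p) (X p) - alpha i (X p) (Y p).
Proof.
move=> DZ oU Up Mp [sX DX] [sY DY].
have H X1 X2 : smooth_on U X2 ->
    (forall q, U q -> M_area A q -> D q (X1 q)) ->
    (forall q, U q -> M_area A q -> D q (X2 q)) ->
    alpha i p ('D_(X1 p) X2 p) = - alpha i (X1 p) (X2 p).
  move=> sX2 DX1 DX2; have dX2 := smooth_on_differentiable sX2 Up.
  have T1 : tangent (M_area A) p (X1 p) by apply: Zs_tangent => //; exact/DZ/DX1.
  have G0 q : U q -> M_area A q -> alpha i q (X2 q) = 0.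
    by move=> Uq Mq; apply: alpha_Zs; exact/DZ/DX2.
  have dG : differentiable (fun q => alpha i q (X2 q)) p.
    have dX j k : differentiable (fun q => X2 q j k) p.
      exact: (differentiable_comp dX2 (differentiable_coord _ _ _)).
    have dq (j l : 'I_3) k : differentiable (fun q : 'M[R]_(3, 2) => q j k - q l k) p.
      by apply: differentiableB; exact: differentiable_coord.
    by apply: differentiableB; apply: differentiableM.
  have := derive_tangent oU Up dG G0 T1.
  have [_ ->] := is_derive_alpha i (X1 p) dX2.
  by move/eqP; rewrite addrC addr_eq0 => /eqP.
rewrite /lie_bracket.
have -> u w : alpha i p (u - w) = alpha i p u - alpha i p w.
  by rewrite /alpha !mxE; ring.
by rewrite !H//; ring.
Qed.

Lemma free_D_ants r : signed_area r != 0 ->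
  free [:: Z_field 0 r - Z_field 1 r; Z_field 2 r - Z_field 0 r].
Proof.
move=> /edge_det[d0 d1 d2]; rewrite free_cons span_seq1 seq1_free.
apply/andP; split; [apply/negP => /vlineP[c]|apply/eqP] => /matrixP uv.
  have := uv 1 0; have := uv 1 1; rewrite !(mxDE, mxNE, mxZE, Z_fieldE).
  rewrite !subr0 !mulr0 !sub0r => /eqP; rewrite oppr_eq0 => /eqP e1.
  move=> /eqP; rewrite oppr_eq0 => /eqP e0.
  by move: d1; rewrite e0 e1 !mul0r subrr eqxx.
have := uv 2 0; have := uv 2 1; rewrite !(mxDE, mxNE, Z_fieldE) subr0.
by rewrite !(mxE const_mx_key) subr0 => e1 e0; move: d2; rewrite e0 e1 !mul0r subrr eqxx.
Qed.

Lemma free_Zs r : signed_area r != 0 -> free (Zs r).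
Proof.
move=> /edge_det[d0 d1 d2]; rewrite /Zs !free_cons span_seq1 span_nil nil_free andbT.
rewrite memv0; apply/and3P; split;
  [apply/negP => /span2P[a [b]]|apply/negP => /vlineP[a]|apply/eqP] => /matrixP uv.
- have := uv 0 0; have := uv 0 1; rewrite !(mxDE, mxZE, Z_fieldE) !mulr0 addr0 => e1 e0.
  by move: d0; rewrite e0 e1 !mul0r subrr eqxx.
- have := uv 1 0; have := uv 1 1; rewrite !(mxZE, Z_fieldE) !mulr0 => e1 e0.
  by move: d1; rewrite e0 e1 !mul0r subrr eqxx.
- have := uv 2 0; have := uv 2 1; rewrite !Z_fieldE !(mxE const_mx_key) => e1 e0.
  by move: d2; rewrite e0 e1 !mul0r subrr eqxx.
Qed.

Lemma derived_D_ants A p : A != 0 -> M_area A p ->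
  derived (M_area A) D_ants p = [set v | v \in <<Zs p>>%VS].
Proof.
move=> A0 Mp; have p0 : signed_area p != 0 by rewrite (Mp : _ = _).
pose X1 : {linear 'M[R]_(3, 2) -> 'M[R]_(3, 2)} := Z_field 0 \- Z_field 1.
pose X2 : {linear 'M[R]_(3, 2) -> 'M[R]_(3, 2)} := Z_field 2 \- Z_field 0.
apply: (lin_span_eq (s := [:: X1 p; X2 p; X2 (X1 p) - X1 (X2 p)])).
- move=> v [|]; first exact: D_ants_Zs.
  move=> [U [X [Y [oU Up sX sY ->]]]]; apply: mem_span_Zs => // i.
  (* What remains is alternating in the two values, and it vanishes because both have coefficients
     of zero sum. *)
  rewrite (alpha_bracket i (fun q v _ => @D_ants_Zs q v) oU Up Mp sX sY).
  have /D_antsP[a [b ->]] := sX.2 p Up Mp; have /D_antsP[c [d ->]] := sY.2 p Up Mp.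
  by move: i; apply: ord3P; rewrite !alphaE !Z_combE; ring.
- have X1D q : D_ants q (X1 q) by rewrite /D_ants/= memv_span// !inE eqxx.
  have X2D q : D_ants q (X2 q) by rewrite /D_ants/= memv_span// !inE eqxx orbT.
  move=> v; rewrite !inE => /or3P[] /eqP ->; [by left|by left|right].
  exact: lie_bracket_derived.
(* The bracket has coefficients of nonzero sum, so it leaves [D_ants]. The fractions below solve for
   each [Z_field i p] in terms of the two generators and this bracket. *)
- have E : X2 (X1 p) - X1 (X2 p) = - (Z_field 0 p + Z_field 1 p + Z_field 2 p).
    apply/matrixP => i k; move: i; apply: ord3P;
      by rewrite /= !(mxDE, mxNE, Z_fieldE); ring.
  rewrite E; apply/span_subvP => v; rewrite !inE => /or3P[] /eqP ->; apply/span3P.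
  + exists (3^-1), (- 3^-1), (- 3^-1); rewrite /X1 /X2 /=.
    move: (Z_field 0 p) (Z_field 1 p) (Z_field 2 p) => x y z.
    by apply/matrixP => i j; rewrite !mxE; field.
  + exists (- 2 / 3), (- 3^-1), (- 3^-1); rewrite /X1 /X2 /=.
    move: (Z_field 0 p) (Z_field 1 p) (Z_field 2 p) => x y z.
    by apply/matrixP => i j; rewrite !mxE; field.
  + exists (3^-1), (2 / 3), (- 3^-1); rewrite /X1 /X2 /=.
    move: (Z_field 0 p) (Z_field 1 p) (Z_field 2 p) => x y z.
    by apply/matrixP => i j; rewrite !mxE; field.
Qed.

(** [W01] and [W12] are Lie brackets of consecutive [Z_field]s, in the commutator form of
    [lie_bracket_linear]. *)
Definition W01 r := Z_field 1 (Z_field 0 r) - Z_field 0 (Z_field 1 r).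
Definition W12 r := Z_field 2 (Z_field 1 r) - Z_field 1 (Z_field 2 r).

Lemma alpha_W r :
  (alpha 0 r (W01 r) = - 2 * signed_area r) *
  (alpha 1 r (W01 r) = 2 * signed_area r) * (alpha 2 r (W01 r) = 0) *
  (alpha 0 r (W12 r) = 0) * (alpha 1 r (W12 r) = - 2 * signed_area r) *
  (alpha 2 r (W12 r) = 2 * signed_area r).
Proof.
by do !split; rewrite ?signed_areaE !alphaE /W01 /W12 !(mxDE, mxNE, Z_fieldE); field.
Qed.

(** Every [alpha i] kills [Zs r]. Moreover [alpha 0] kills [W12 r] but not [W01 r], and [alpha 1]
    does not kill [W12 r]. *)
Lemma free_WZs r : signed_area r != 0 -> free [:: W01 r, W12 r & Zs r].
Proof.
move=> r0; rewrite !(free_cons (W01 r), free_cons (W12 r)) free_Zs// andbT.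
have d0 : - 2 * signed_area r != 0.
  by rewrite mulf_neq0// oppr_eq0 pnatr_eq0.
apply/andP; split; apply/negP.
  rewrite span_cons => /memv_addP[_ /vlineP[c ->] [u /(alpha_Zs 0) u0 WE]].
  move: d0; rewrite -(alpha_W r) WE => /eqP; apply.
  have -> : alpha 0 r (c *: W12 r + u) = c * alpha 0 r (W12 r) + alpha 0 r u.
    by move: (W12 r) => w; rewrite !alphaE !mxE; ring.
  by rewrite u0 !alpha_W mulr0 addr0.
by move=> /(alpha_Zs 1); rewrite !alpha_W; exact/eqP.
Qed.

Lemma mem_span_WZs r v : signed_area r != 0 -> \sum_i alpha i r v = 0 ->
  v \in <<[:: W01 r, W12 r & Zs r]>>%VS.
Proof.
move=> r0; rewrite sum_alpha => sv; rewrite !span_cons -/(Zs r).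
(* [s] and [t] are chosen to cancel [alpha 0] and [alpha 2] of the remainder; [alpha 1] then
   vanishes because the sum of the three does. *)
pose s := - alpha 0 r v / (2 * signed_area r).
pose t := alpha 2 r v / (2 * signed_area r).
have -> : v = s *: W01 r + (t *: W12 r + (v - s *: W01 r - t *: W12 r)).
  by rewrite addrA -[v - _ - _]addrA -opprD addrC subrK.
rewrite memv_add ?memvZ ?memv_line// memv_add ?memvZ ?memv_line//.
rewrite -!span_cons; apply: mem_span_Zs => // i.
have -> : alpha i r (v - s *: W01 r - t *: W12 r) =
    alpha i r v - s * alpha i r (W01 r) - t * alpha i r (W12 r).
  by move: (W01 r) (W12 r) => w w'; rewrite /alpha !mxE; ring.
move: i; apply: ord3P; rewrite !alpha_W /s /t.
- by field.
- rewrite -[RHS]sv. by field.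
- by field.
Qed.

Lemma derived2_D_ants A p : A != 0 -> M_area A p ->
  derived (M_area A) (derived (M_area A) D_ants) p =
  [set v | v \in <<[:: W01 p, W12 p & Zs p]>>%VS].
Proof.
move=> A0 Mp; have p0 : signed_area p != 0 by rewrite (Mp : _ = _).
have DZ q v : M_area A q -> derived (M_area A) D_ants q v -> v \in <<Zs q>>%VS.
  by move=> Mq; rewrite derived_D_ants.
have ZD i q : M_area A q -> derived (M_area A) D_ants q (Z_field i q).
  move=> Mq; rewrite derived_D_ants//= memv_span//.
  by move: i; apply: ord3P; rewrite !inE eqxx ?orbT.
apply: (lin_span_eq (s := [:: W01 p, W12 p & Zs p])) => //.
- move=> v Sv; apply: mem_span_WZs => //; case: Sv => [|[U [X [Y [oU Up sX sY ->]]]]].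
    by move=> /(DZ _ _ Mp) vZ; rewrite big1// => i _; exact: alpha_Zs.
  under eq_bigr do rewrite (alpha_bracket _ DZ oU Up Mp sX sY).
  by rewrite sumrB sum_alphaC subrr.
- move=> v; rewrite !inE => /or3P[/eqP ->|/eqP ->|]; last first.
  + move=> vZ; left; rewrite derived_D_ants//= memv_span//.
    by rewrite !inE.
  + by right; apply: lie_bracket_derived => q; exact: ZD.
  + by right; apply: lie_bracket_derived => q; exact: ZD.
Qed.

Lemma rank_D_ants A : A != 0 -> rank_distribution 2 (M_area A) D_ants.
Proof.
move=> A0 p Mp.
pose X1 : {linear 'M[R]_(3, 2) -> 'M[R]_(3, 2)} := Z_field 0 \- Z_field 1.
pose X2 : {linear 'M[R]_(3, 2) -> 'M[R]_(3, 2)} := Z_field 2 \- Z_field 0.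
pose X (i : 'I_2) := if i == 0 then X1 else X2.
exists setT, (fun i => X i); split=> //; first exact: openT.
  by move=> i; exact: smooth_on_mx_linear.
move=> q _ Mq; have q0 : signed_area q != 0 by rewrite (Mq : _ = _).
have -> : [seq X i q | i <- enum 'I_2] =
    [:: Z_field 0 q - Z_field 1 q; Z_field 2 q - Z_field 0 q].
  by rewrite !enum_ordSl enum_ord0.
split=> //; last exact: free_D_ants.
by move=> v /D_ants_Zs; exact: Zs_tangent.
Qed.

Lemma distribution_235_D_ants A : A != 0 -> distribution_235 (M_area A) D_ants.
Proof.
move=> A0; split; [exact: submanifold_M_area|exact: rank_D_ants|].
move=> p Mp; have p0 : signed_area p != 0 by rewrite (Mp : _ = _).
split; rewrite /derived_flag /=.
- exists (span [:: Z_field 0 p - Z_field 1 p; Z_field 2 p - Z_field 0 p]) => //.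
  by have /eqP := free_D_ants p0.
- rewrite derived_D_ants//; exists <<Zs p>>%VS => //.
  by have /eqP := free_Zs p0.
- rewrite derived2_D_ants//; exists <<[:: W01 p, W12 p & Zs p]>>%VS => //.
  by have /eqP := free_WZs p0.
Qed.

End AntDistribution.

(** * The group *)

Section Group.
Context {R : realType}.
Implicit Types g h H K : 'M[R]_3.

Definition minor h := h 0 0 * h 1 1 - h 0 1 * h 1 0.

(** Trades the parametrisation for polynomial equations, which can be differentiated. *)
Lemma SL2_R2P h : SL2_R2 h <-> [/\ h 2 0 = 0, h 2 1 = 0, h 2 2 = 1 & minor h = 1].
Proof.
split=> [[a [b [x [p [q [y [-> d]]]]]]]|[h20 h21 h22 d]].
  by split; rewrite /minor !mxE.
exists (h 0 0), (h 0 1), (h 0 2), (h 1 0), (h 1 1), (h 1 2); split=> //.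
by apply/matrixP; apply: ord3P; apply: ord3P; rewrite !mxE.
Qed.

Lemma mulmx3E g h i j :
  (g *m h) i j = g i 0 * h 0 j + g i 1 * h 1 j + g i 2 * h 2 j.
Proof.
have o1 : lift ord0 ord0 = 1 :> 'I_3 by exact: val_inj.
have o2 : lift ord0 (lift ord0 ord0) = 2 :> 'I_3 by exact: val_inj.
by rewrite mxE !big_ord_recl big_ord0 addr0 addrA o1 o2.
Qed.

Lemma SL2_R2M g h : SL2_R2 g -> SL2_R2 h -> SL2_R2 (g *m h).
Proof.
move=> /SL2_R2P[g20 g21 g22 dg] /SL2_R2P[h20 h21 h22 dh]; apply/SL2_R2P.
rewrite /minor !mulmx3E g20 g21 g22 h20 h21 h22; split; try ring.
by rewrite -[RHS]mulr1 -{1}dg -dh /minor; ring.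
Qed.

Lemma SL2_R2_inverse h : SL2_R2 h -> exists2 g, SL2_R2 g & h *m g = 1%:M.
Proof.
move=> /SL2_R2P[h20 h21 h22 dh].
(* The linear part is the adjugate of that of [h], and the last column is minus this adjugate
   applied to the translation. *)
exists (mx33 [:: [:: h 1 1; - h 0 1; h 0 1 * h 1 2 - h 1 1 * h 0 2];
                 [:: - h 1 0; h 0 0; h 1 0 * h 0 2 - h 0 0 * h 1 2];
                 [:: 0; 0; 1]]).
  by apply/SL2_R2P; rewrite /minor !mxE /=; split=> //; rewrite -dh /minor; ring.
rewrite /minor in dh.
apply/matrixP; apply: ord3P; apply: ord3P; rewrite mulmx3E !mxE /=
  ?h20 ?h21 ?h22 ?mulr1n ?mulr0n; try solve [ring].
- by rewrite -[RHS]dh; ring.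
- rewrite [LHS](_ : _ = h 0 2 * (1 - (h 0 0 * h 1 1 - h 0 1 * h 1 0))); last by ring.
  by rewrite dh subrr mulr0.
- by rewrite -[RHS]dh; ring.
- rewrite [LHS](_ : _ = h 1 2 * (1 - (h 0 0 * h 1 1 - h 0 1 * h 1 0))); last by ring.
  by rewrite dh subrr mulr0.
Qed.

Lemma SL2_R2_unit h : SL2_R2 h -> h \in unitmx.
Proof. by move=> /SL2_R2_inverse[g _ /mulmx1_unit[]]. Qed.

Lemma SL2_R2V h : SL2_R2 h -> SL2_R2 (invmx h).
Proof.
move=> Sh; have [g Sg hg] := SL2_R2_inverse Sh.
by rewrite -[invmx h]mulmx1 -hg mulKmx//; exact: SL2_R2_unit.
Qed.

Lemma is_derive_minor h H :
  is_derive h H minor (H 0 0 * h 1 1 + h 0 0 * H 1 1 - (H 0 1 * h 1 0 + h 0 1 * H 1 0)).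
Proof.
have DX j k : is_derive h H (fun q : 'M[R]_3 => q j k) (H j k).
  by apply: is_derive_coord; exact: is_derive_id.
have D := is_deriveB (is_deriveM (DX 0 0) (DX 1 1)) (is_deriveM (DX 0 1) (DX 1 0)).
by apply: (is_derive_eq D); rewrite /GRing.scale /=; ring.
Qed.

Lemma smooth_on_minor (U : set 'M[R]_3) : open U -> smooth_on U minor.
Proof.
by move=> oU; apply: smooth_onD => //; [|apply: smooth_onN => //];
  apply: smooth_onM => //; exact: smooth_on_coord.
Qed.

(** The equations of the group are differentiated at the identity, where the derivative of [minor]
    is the trace of the upper left block. Other points are reached by left translation. *)
Lemma tangent_SL2_R2_1 K : tangent SL2_R2 1%:M K ->
  [/\ K 2 0 = 0, K 2 1 = 0, K 2 2 = 0 & K 0 0 + K 1 1 = 0].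
Proof.
move=> TK; have TK2 j : K 2 j = 0.
  have dc := differentiable_coord (1%:M : 'M[R]_3) 2 j.
  have cst2 (q : 'M[R]_3) : setT q -> SL2_R2 q -> q 2 j = (j == 2)%:R.
    by move=> _ /SL2_R2P[q20 q21 q22 _]; move: j {dc}; apply: ord3P.
  have := derive_tangent openT I dc cst2 TK.
  by have [_ ->] := is_derive_coord 2 j (is_derive_id (1%:M : 'M[R]_3) K).
split=> //; have dm := smooth_on_differentiable (smooth_on_minor openT)
  (I : setT (1%:M : 'M[R]_3)).
have cst1 (q : 'M[R]_3) : setT q -> SL2_R2 q -> minor q = 1 by move=> _ /SL2_R2P[].
have := derive_tangent openT I dm cst1 TK.
by have [_ ->] := is_derive_minor 1%:M K; rewrite !mxE /= => <-; ring.
Qed.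

Lemma tangent_SL2_R2 g h H : SL2_R2 g ->
  tangent SL2_R2 h H -> tangent SL2_R2 (g *m h) (g *m H).
Proof.
move=> Sg TH; have := @tangent_affine _ _ _ _ _ SL2_R2 SL2_R2 (mulmx g) 0 _ _ _ TH.
by rewrite /= addr0; apply=> q Sq; rewrite addr0; exact: SL2_R2M.
Qed.

(** Explicit coordinates dual to [E_mx], standing in for the abstract [coord] inside [tau]; they
    reconstruct a matrix whose last row is zero. *)
Definition E_coef (i : 'I_6) K : R :=
  nth 0 [:: K 0 1; K 1 0; (K 0 0 - K 1 1) / 2; K 0 2; K 1 2; (K 0 0 + K 1 1) / 2] i.

Lemma E_coef_linear i : linear (E_coef i : 'M[R]_3 -> R^o).
Proof.
move=> a u v; rewrite /E_coef /GRing.scale.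
by case: i => [[|[|[|[|[|[|//]]]]]] ?] /=; rewrite !mxE//; field.
Qed.
HB.instance Definition _ i :=
  GRing.isLinear.Build R 'M[R]_3 R^o *:%R (E_coef i) (E_coef_linear i).

Lemma E_coef_E_mx (i j : 'I_6) : E_coef i E_mx`_j = (i == j)%:R.
Proof.
case: i => [[|[|[|[|[|[|//]]]]]] ?]; case: j => [[|[|[|[|[|[|//]]]]]] ?];
  rewrite /E_coef /= !mxE/=; by field.
Qed.

Lemma E_coef_sum (k : 'I_6 -> R) i : E_coef i (\sum_j k j *: E_mx`_j) = k i.
Proof.
rewrite linear_sum (bigD1 i)//= linearZ /= E_coef_E_mx eqxx [X in X + _]mulr1.
by rewrite big1 ?addr0// => j /negbTE ji; rewrite linearZ /= E_coef_E_mx eq_sym ji [LHS]mulr0.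
Qed.

Lemma free_E_mx : free (@E_mx R).
Proof. by apply/freeP => k k0 i; rewrite -(E_coef_sum k) k0 linear0. Qed.

Lemma E_mx_sum K : K 2 0 = 0 -> K 2 1 = 0 -> K 2 2 = 0 ->
  K = \sum_i E_coef i K *: E_mx`_i.
Proof.
move=> K20 K21 K22; apply/matrixP => i j; rewrite summxE !big_ord_recl big_ord0.
move: i j; apply: ord3P; apply: ord3P; by rewrite /E_coef /= !mxE /= ?K20 ?K21 ?K22; field.
Qed.

Lemma tauE (i : 'I_6) h H (K := invmx h *m H) :
  K 2 0 = 0 -> K 2 1 = 0 -> K 2 2 = 0 -> tau i.+1 h H = E_coef i K.
Proof.
move=> K20 K21 K22; rewrite /tau /= inord_val -/K {1}(E_mx_sum K20 K21 K22).
by rewrite coord_sum_free ?free_E_mx.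
Qed.

Lemma tangent_SL2_R2_invmx h H (K := invmx h *m H) : SL2_R2 h -> tangent SL2_R2 h H ->
  [/\ K 2 0 = 0, K 2 1 = 0, K 2 2 = 0 & K 0 0 + K 1 1 = 0].
Proof.
move=> Sh TH; apply: tangent_SL2_R2_1; rewrite -(mulVmx (SL2_R2_unit Sh)).
exact/tangent_SL2_R2/TH/SL2_R2V.
Qed.

(** Left translation brings [H] to the Lie algebra: the zero last row gives the expansion and the
    zero trace kills the last coefficient. *)
Lemma maurer_cartan h H : SL2_R2 h -> tangent SL2_R2 h H ->
  invmx h *m H = \sum_(i < 6) tau i.+1 h H *: tnth E_mx i /\ tau 6 h H = 0.
Proof.
move=> Sh TH; have [K20 K21 K22 trK] := tangent_SL2_R2_invmx Sh TH; split.
  rewrite [LHS]E_mx_sum//; apply: eq_bigr => i _.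
  by rewrite tauE// (tnth_nth 0).
by rewrite (tauE (Ordinal (erefl : (5 < 6)%N)))// /E_coef /= trK mul0r.
Qed.

(** Zero trace makes [tau 3] equal to [K 0 0]; the three forms then read as linear conditions on the
    entries of [K]. *)
Lemma D_thetaP h H (K := invmx h *m H) : SL2_R2 h -> tangent SL2_R2 h H ->
  D_theta h H <-> [/\ K 0 0 = K 1 2, K 0 2 = - K 1 2 & K 0 1 = K 1 0 + K 0 0].
Proof.
move=> Sh TH; have [K20 K21 K22 trK] := tangent_SL2_R2_invmx Sh TH.
have t1 : tau 1 h H = K 0 1 by rewrite (tauE (Ordinal (erefl : (0 < 6)%N))).
have t2 : tau 2 h H = K 1 0 by rewrite (tauE (Ordinal (erefl : (1 < 6)%N))).
have t3 : tau 3 h H = (K 0 0 - K 1 1) / 2 by rewrite (tauE (Ordinal (erefl : (2 < 6)%N))).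
have t4 : tau 4 h H = K 0 2 by rewrite (tauE (Ordinal (erefl : (3 < 6)%N))).
have t5 : tau 5 h H = K 1 2 by rewrite (tauE (Ordinal (erefl : (4 < 6)%N))).
rewrite /D_theta /theta1 /theta2 /theta3 /= t1 t2 t3 t4 t5.
rewrite -/K in trK; split=> [[_ e1 e2 e3]|[e1 e2 e3]]; split=> //; lra.
Qed.

(** Left invariance: translating by [g] leaves [invmx h *m H] unchanged, and [D_thetaP] only sees
    this matrix. *)
Lemma D_theta_mulmx g h H : SL2_R2 g -> SL2_R2 h ->
  D_theta h H -> D_theta (g *m h) (g *m H).
Proof.
move=> Sg Sh DH; have TH := let: And4 T _ _ _ := DH in T.
have Ug := SL2_R2_unit Sg; have Uh := SL2_R2_unit Sh.
have := (D_thetaP Sh TH).1 DH; have := D_thetaP (SL2_R2M Sg Sh) (tangent_SL2_R2 Sg TH).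
have -> : invmx (g *m h) *m (g *m H) = invmx h *m H.
  have U : g *m h \in unitmx by rewrite unitmx_mul Ug Uh.
  by apply: (can_inj (mulKmx U)); rewrite mulKVmx// -mulmxA mulKVmx.
by move=> [_].
Qed.

Lemma homogeneous_D_theta : homogeneous (@SL2_R2 R) D_theta.
Proof.
move=> p Sp; exists setT; split=> //; first exact: openT.
move=> q _ Sq; pose g := q *m invmx p.
have Sg : SL2_R2 g by apply: SL2_R2M => //; exact: SL2_R2V.
have Ug := SL2_R2_unit Sg; have Up := SL2_R2_unit Sp.
(* The added zero gives the translation the affine shape of [affine_local_equivalence]. *)
exists (fun h => g *m h + 0); split; last by rewrite addr0 mulmxKV.
apply: (@affine_local_equivalence _ _ _ _ _ _ _ (mulmx g) (mulmx (invmx g))) => //=.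
- by move=> h Sh; rewrite addr0; exact: SL2_R2M.
- by move=> h Sh; apply: SL2_R2M => //; exact: SL2_R2V.
- exact: mulKmx.
- by rewrite mulmx0.
- by move=> h Sh; rewrite addr0 mulKVmx.
- move=> h Sh; rewrite addr0; apply/seteqP; split=> [H DH|_ [H DH <-]];
    last exact: D_theta_mulmx.
  exists (invmx g *m H); last by rewrite mulKVmx.
  rewrite -(mulKmx Ug h); apply: D_theta_mulmx => //; [exact: SL2_R2V|exact: SL2_R2M].
Qed.

End Group.

(** * The group as a submanifold *)

Section GroupManifold.
Context {R : realType}.

Definition SL2_R2_eqn (i : 'I_4) (q : 'M[R]_3) : R :=
  nth 0 [:: q 2 0; q 2 1; q 2 2 - 1; minor q - 1] i.

Definition SL2_R2_deqn (i : 'I_4) (q v : 'M[R]_3) : R :=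
  nth 0 [:: v 2 0; v 2 1; v 2 2;
    v 0 0 * q 1 1 + q 0 0 * v 1 1 - (v 0 1 * q 1 0 + q 0 1 * v 1 0)] i.

Lemma smooth_SL2_R2_eqn i (U : set 'M[R]_3) : open U -> smooth_on U (SL2_R2_eqn i).
Proof.
move=> oU; case: i => [[|[|[|[|//]]]] ?]; rewrite /SL2_R2_eqn /=.
- exact: smooth_on_coord.
- exact: smooth_on_coord.
- by apply: smooth_onD => //; [exact: smooth_on_coord|exact: smooth_on_cst].
- by apply: smooth_onD => //; [exact: smooth_on_minor|exact: smooth_on_cst].
Qed.

Lemma diff_SL2_R2_eqn i q v : 'd (SL2_R2_eqn i) q v = SL2_R2_deqn i q v.
Proof.
rewrite -deriveE; last first.
  exact: smooth_on_differentiable (smooth_SL2_R2_eqn i openT) _.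
suff [] : is_derive q v (SL2_R2_eqn i) (SL2_R2_deqn i q v) by [].
have DX j k : is_derive q v (fun q : 'M[R]_3 => q j k) (v j k).
  by apply: is_derive_coord; exact: is_derive_id.
case: i => [[|[|[|[|//]]]] ?]; rewrite /SL2_R2_eqn /SL2_R2_deqn /=.
- exact: DX.
- exact: DX.
- have D := is_deriveB (DX 2 2) (is_derive_cst (1 : R) q v).
  by apply: (is_derive_eq D); rewrite subr0.
- have D := is_deriveB (is_derive_minor q v) (is_derive_cst (1 : R) q v).
  by apply: (is_derive_eq D); rewrite subr0.
Qed.

Lemma submanifold_SL2_R2 : submanifold 5 (@SL2_R2 R).
Proof.
move=> p /SL2_R2P[p20 p21 p22 dp]; exists [set q | minor q != 0], 4%N, SL2_R2_eqn.
have cm : continuous (@minor R).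
  by move=> q; have := smooth_on_minor openT 0%N; exact.
have oU : open [set q : 'M[R]_3 | minor q != 0].
  apply: (@open_comp _ _ (@minor R) [set x | x != 0]) => [q _|]; first exact: cm.
  exact: open_neq.
split=> //.
- by rewrite /= dp oner_neq0.
- by move=> i; exact: smooth_SL2_R2_eqn.
split=> q Uq.
  split=> [/SL2_R2P[q20 q21 q22 dq]|Fq].
    by case=> [[|[|[|[|//]]]] ?]; rewrite /SL2_R2_eqn /= ?q20 ?q21 ?q22 ?dq ?subrr.
  apply/SL2_R2P; split.
  - exact: (Fq (@Ordinal 4 0 isT)).
  - exact: (Fq (@Ordinal 4 1 isT)).
  - by apply/eqP; rewrite -subr_eq0; apply/eqP; exact: (Fq (@Ordinal 4 2 isT)).
  - by apply/eqP; rewrite -subr_eq0; apply/eqP; exact: (Fq (@Ordinal 4 3 isT)).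
move=> a aE.
have {}aE (v : 'M[R]_3) : a 0 * v 2 0 + a 1 * v 2 1 + a 2 * v 2 2 + a 3 *
   (v 0 0 * q 1 1 + q 0 0 * v 1 1 - (v 0 1 * q 1 0 + q 0 1 * v 1 0)) = 0.
  rewrite -[RHS](aE v) !big_ord_recl big_ord0 addr0 !diff_SL2_R2_eqn /SL2_R2_deqn /=.
  by rewrite !addrA; congr (a _ * _ + a _ * _ + a _ * _ + a _ * _); exact: val_inj.
(* Matrix units of the last row isolate the first three coefficients. The upper left block of [q]
   isolates the fourth: by homogeneity, [minor] has derivative [2 * minor q] along it. *)
have a0 := aE (delta_mx 2 0); have a1 := aE (delta_mx 2 1); have a2 := aE (delta_mx 2 2).
have a3 := aE (mx33 [:: [:: q 0 0; q 0 1; 0]; [:: q 1 0; q 1 1; 0]; [:: 0; 0; 0]]).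
move: a0 a1 a2 a3; rewrite !mxE /=.
rewrite !(mulr1, mulr0, mul0r, addr0, add0r, subr0, oppr0) => a0 a1 a2 a3.
have {}a3 : a 3 = 0.
  apply: (mulIf Uq); rewrite mul0r; apply: (@mulfI _ 2); first by rewrite pnatr_eq0.
  by rewrite mulr0 -[RHS]a3 /minor; ring.
case=> [[|[|[|[|//]]]] lti].
- by rewrite -[RHS]a0; congr (a _); exact: val_inj.
- by rewrite -[RHS]a1; congr (a _); exact: val_inj.
- by rewrite -[RHS]a2; congr (a _); exact: val_inj.
- by rewrite -[RHS]a3; congr (a _); exact: val_inj.
Qed.

End GroupManifold.

(** * The equivalence *)

Section Frame.
Context {R : realType}.
Variable c : R.

(** The columns are two edges and the origin, with the first coordinate scaled by [c]. The corner
    entry 1 is left to [delta_mx 2 2], which keeps the map linear. *)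
Definition frame (v : 'M[R]_(3, 2)) : 'M[R]_3 :=
  mx33 [:: [:: c * (v 1 0 - v 0 0); c * (v 2 0 - v 0 0); c * v 0 0];
           [:: v 1 1 - v 0 1; v 2 1 - v 0 1; v 0 1]; [:: 0; 0; 0]].

Definition unframe (h : 'M[R]_3) : 'M[R]_(3, 2) :=
  \matrix_(i, k) nth 0 (nth [::]
    [:: [:: c^-1 * h 0 2; h 1 2];
        [:: c^-1 * (h 0 2 + h 0 0); h 1 2 + h 1 0];
        [:: c^-1 * (h 0 2 + h 0 1); h 1 2 + h 1 1]] i) k.

Lemma frame_linear : linear frame.
Proof.
move=> a u v; apply/matrixP; apply: ord3P; apply: ord3P; rewrite !mxE /=; ring.
Qed.
HB.instance Definition _ :=
  GRing.isLinear.Build R 'M[R]_(3, 2) 'M[R]_3 *:%R frame frame_linear.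

Lemma unframe_linear : linear unframe.
Proof.
move=> a u v; apply/matrixP; apply: ord3P; apply: ord2P; rewrite !mxE /=; ring.
Qed.
HB.instance Definition _ :=
  GRing.isLinear.Build R 'M[R]_3 'M[R]_(3, 2) *:%R unframe unframe_linear.

Hypothesis c0 : c != 0.

Lemma frameK : cancel frame unframe.
Proof.
by move=> v; apply/matrixP; apply: ord3P; apply: ord2P; rewrite !mxE /=; field.
Qed.

Lemma unframe_delta : unframe (delta_mx 2 2) = 0.
Proof.
by apply/matrixP; apply: ord3P; apply: ord2P; rewrite !mxE /=; ring.
Qed.

Lemma unframeK h : SL2_R2 h -> frame (unframe h) + delta_mx 2 2 = h.
Proof.
move=> /SL2_R2P[h20 h21 h22 _]; apply/matrixP; apply: ord3P; apply: ord3P;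
  by rewrite !mxE /= ?h20 ?h21 ?h22; field.
Qed.

Lemma minor_frame r : minor (frame r + delta_mx 2 2) = c * (- 2 * signed_area r).
Proof. by rewrite signed_areaE /minor !mxE /=; field. Qed.

End Frame.

Section Equivalence.
Context {R : realType} (A : R).
Hypothesis A0 : A != 0.

(** By [minor_frame], this scaling gives frames of triangles of area [A] determinant one. *)
Let c : R := (- 2 * A)^-1.

Let twoA0 : - 2 * A != 0.
Proof. by rewrite mulf_neq0// oppr_eq0 pnatr_eq0. Qed.

Let c0 : c != 0. Proof. by rewrite invr_eq0. Qed.

Lemma SL2_R2_frame r : M_area A r -> SL2_R2 (frame c r + delta_mx 2 2).
Proof.
move=> Mr; apply/SL2_R2P; rewrite minor_frame (Mr : _ = _) mulVf//.
by rewrite !mxE /= !add0r.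
Qed.

Lemma M_area_unframe h : SL2_R2 h -> M_area A (unframe c h).
Proof.
move=> Sh; have /SL2_R2P[_ _ _] := Sh; rewrite -{1}(unframeK c0 Sh) minor_frame.
move=> /(congr1 ( *%R (- 2 * A))); rewrite mulrA mulfV// mul1r mulr1.
by apply: mulfI; rewrite oppr_eq0 pnatr_eq0.
Qed.

(** [K1] and [K2] are the Lie algebra elements whose left-invariant fields are the images under
    [frame] of the two generators of [D_ants]. They do not involve [c], since scaling the first
    coordinate is a multiplication on the left. *)
Definition K1 : 'M[R]_3 := mx33 [:: [:: -1; -1; 1]; [:: 0; 1; -1]; [:: 0; 0; 0]].
Definition K2 : 'M[R]_3 := mx33 [:: [:: 1; 0; -1]; [:: -1; -1; 1]; [:: 0; 0; 0]].

Lemma frame_D_ants r a b :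
  frame c (a *: (Z_field 0 r - Z_field 1 r) + b *: (Z_field 2 r - Z_field 0 r)) =
  (frame c r + delta_mx 2 2) *m (a *: K1 + b *: K2).
Proof.
apply/matrixP; apply: ord3P; apply: ord3P; rewrite mulmx3E [LHS]mxE /=
  !(mxDE, mxNE, mxZE, Z_fieldE) !mxE /=; ring.
Qed.

Lemma D_theta_frame r : M_area A r ->
  D_theta (frame c r + delta_mx 2 2) = frame c @` D_ants r.
Proof.
move=> Mr; have Sf := SL2_R2_frame Mr; set h := frame c r + _ in Sf *.
have Uh := SL2_R2_unit Sf.
apply/seteqP; split=> [H DH|_ [v Dv <-]].
  have TH : tangent SL2_R2 h H by case: DH.
  have [K20 K21 K22 trK] := tangent_SL2_R2_invmx Sf TH.
  have [e1 e2 e3] := (D_thetaP Sf TH).1 DH.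
  set K := invmx h *m H in K20 K21 K22 trK e1 e2 e3.
  (* In [a *: K1 + b *: K2] the entries [0 0] and [1 0] are [b - a] and [- b], which determines the
     coefficients. *)
  have KE : K = (- K 1 0 - K 0 0) *: K1 + (- K 1 0) *: K2.
    apply/matrixP; apply: ord3P; apply: ord3P;
      rewrite mxDE 2!mxZE !(mxE matrix_key) /=; lra.
  exists ((- K 1 0 - K 0 0) *: (Z_field 0 r - Z_field 1 r) +
          (- K 1 0) *: (Z_field 2 r - Z_field 0 r)).
    by apply/span2P; do 2!eexists.
  by rewrite frame_D_ants -KE -/h mulKVmx.
have Tv : tangent SL2_R2 h (frame c v).
  apply: (tangent_affine (L := frame c)); first exact: SL2_R2_frame.
  by apply: Zs_tangent => //; exact: D_ants_Zs.
apply/(D_thetaP Sf Tv); case/span2P: Dv => a [b ->].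
rewrite frame_D_ants -/h mulKmx// !mxE /=; split; ring.
Qed.

End Equivalence.

Theorem proposition6p1 (R : realType) (A : R) (hA : A <> 0) :
  [/\ distribution_235 (M_area A) D_ants,
      (forall h H : 'M[R]_3, SL2_R2 h -> tangent SL2_R2 h H ->
         invmx h *m H = \sum_(i < 6) tau i.+1 h H *: tnth E_mx i /\
         tau 6 h H = 0),
      distribution_235 (@SL2_R2 R) D_theta,
      homogeneous (@SL2_R2 R) D_theta &
      locally_equivalent (M_area A) D_ants (@SL2_R2 R) D_theta].
Proof.
have A0 : A != 0 by apply/eqP.
have c0 : (- 2 * A)^-1 != 0 by rewrite invr_eq0 mulf_neq0// oppr_eq0 pnatr_eq0.
have D1 := distribution_235_D_ants A0.
split=> //.
- exact: maurer_cartan.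
(* The growth vector on the group is transported from the triangles, not computed again. *)
- apply: (distribution_235_image (SL2_R2_frame A0) (M_area_unframe A0)
    (frameK c0) (unframe_delta _) (unframeK c0) (D_theta_frame A0)) => //.
    by move=> p Mp v; rewrite derived_D_ants//; exact: Zs_tangent.
  exact: submanifold_SL2_R2.
- exact: homogeneous_D_theta.
- move=> p Mp; eexists.
  exact: (affine_local_equivalence (SL2_R2_frame A0) (M_area_unframe A0)
    (frameK c0) (unframe_delta _) (unframeK c0) (D_theta_frame A0)).
Qed.
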